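(* Let $M$ be a matroid on the ground set $[n]$, $n\geq 2$. Then $M$ is a split matroid if and only if at most one connected component of $M$ is a non-uniform split matroid and all other connected components are uniform.
   Context: Let $M$ be a matroid of rank $d$ on $[n]$ with rank function $\operatorname{rk}$. The matroid polytope $P(M)\subset\mathbb{R}^n$ is the convex hull of the characteristic vectors of the bases of $M$; it is contained in the hypersimplex $\Delta(d,n)=P(U_{d,n})=[0,1]^n\cap\{\sum_i x_i=d\}$. For a flat $F$, let $P_M(F)=\{x\in P(M):\sum_{i\in F}x_i=\operatorname{rk}(F)\}$. A flacet of $M$ is a flat $F$ such that $P_M(F)$ is a facet of $P(M)$ and $F$ is minimal with respect to inclusion among all flats defining the same facet. The $F$-hyperplane is given by $(d-\operatorname{rk}(F))\sum_{i\in F}x_i=\operatorname{rk}(F)\sum_{j\notin F}x_j$, equivalently (on $\sum_i x_i=d$) by $\sum_{i\in F}x_i=\operatorname{rk}(F)$. A split of a polytope $P$ is a polytopal subdivision of $P$ (without new vertices) with exactly two maximal cells; its split hyperplane is the affine span of the common codimension-one cell. A split flacet of $M$ is a flacet $F$ such that the $F$-hyperplane defines a split of $\Delta(d,n)$. Two splits of a polytope $P$ are compatible if their split hyperplanes do not meet in a relatively interior point of $P$. The matroid $M$ is a split matroid if its split flacets form a compatible system of splits of the polytope $\operatorname{aff}(P(M))\cap[0,1]^n$, i.e. for any two distinct split flacets $F,G$ the $F$-hyperplane and the $G$-hyperplane do not meet in a relatively interior point of $\operatorname{aff}(P(M))\cap[0,1]^n$. A connected component $C$ of $M$ is identified with the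 matroid $M|C$, to which the same definitions apply on the ground set $C$. *)

(* Defs.v *)
From HB Require Import structures.
From mathcomp Require Import all_boot all_order all_algebra.
From mathcomp Require Import boolp classical_sets cardinality reals.

Set Implicit Arguments.
Unset Strict Implicit.
Unset Printing Implicit Defensive.

Import Order.TTheory GRing.Theory Num.Theory.

Local Open Scope ring_scope.

(* {set T} is used for subsets of a ground set, [set E] for sets of points. *)

Record matroid (T : finType) := Matroid {
  indep : pred {set T};
  indep0 : indep finset.set0;
  indepS : forall I J : {set T}, I \subset J -> indep J -> indep I;
  indep_exchange : forall I J : {set T}, indep I -> indep J ->
    (#|I| < #|J|)%N -> exists2 x, x \in J :\: I & indep (x |: I) }.

Section MatroidDefs.
Variables (T : finType) (M : matroid T).
Implicit Types (A B F C : {set T}).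

Definition basis B := maxset (indep M) B.

Definition rank A := (\max_(I : {set T} | (I \subset A) && indep M I) #|I|)%N.

Definition flat F := [forall x, (x \notin F) ==> (rank F < rank (x |: F))%N].

(* M is the uniform matroid U_{d,n}, where d is the rank of M and n = #|T|. *)
Definition uniform := forall B, basis B = (#|B| == rank [set: T]).

(* M is the direct sum of its restrictions to C and to the complement of C. *)
Definition separator C :=
  [forall I : {set T}, indep M I == indep M (I :&: C) && indep M (I :\: C)].

Definition component C :=
  minset (fun S => (S != finset.set0) && separator S) C.

End MatroidDefs.

Section Restriction.
Variables (T : finType) (M : matroid T) (C : {set T}).

Let rindep : pred {set {x : T | x \in C}} := fun I => indep M (val @: I).

Fact restrict_indep0 : rindep finset.set0.
Proof. by rewrite /rindep imset0 indep0. Qed.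

Fact restrict_indepS (I J : {set {x : T | x \in C}}) :
  I \subset J -> rindep J -> rindep I.
Proof. by move=> IJ; apply: indepS; exact: imsetS. Qed.

Fact restrict_exchange (I J : {set {x : T | x \in C}}) :
  rindep I -> rindep J -> (#|I| < #|J|)%N ->
  exists2 x, x \in J :\: I & rindep (x |: I).
Proof.
rewrite -(card_imset (mem I) val_inj) -(card_imset (mem J) val_inj).
move=> hI hJ /(indep_exchange hI hJ) [_ /setDP[/imsetP[x xJ ->] xI] hx].
exists x; first by rewrite finset.inE xJ andbT; apply: contra xI; exact: imset_f.
by rewrite /rindep imsetU1.
Qed.

(* M|C *)
Definition restrict : matroid {x : T | x \in C} :=
  Matroid restrict_indep0 restrict_indepS restrict_exchange.

End Restriction.

Section Polytopes.
Local Open Scope classical_set_scope.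
Variables (R : realType) (T : finType).

(* The points of R^T; R^o is R as a module over itself, so that E is a
   finite-dimensional vector space. *)
Local Notation E := {ffun T -> R^o}.
Implicit Types (P Q S H : set E) (x y l : E).

Definition aff S : set E :=
  [set x : E | exists (k : nat) (c : 'I_k -> R) (p : 'I_k -> E),
     [/\ forall i, S (p i), \sum_i c i = 1 & x = \sum_i c i *: p i]].

Definition conv S : set E :=
  [set x : E | exists (k : nat) (c : 'I_k -> R) (p : 'I_k -> E),
     [/\ forall i, S (p i), forall i, 0 <= c i, \sum_i c i = 1
       & x = \sum_i c i *: p i]].

(* The dimension of S is that of the linear space of directions of its affine
   span; the empty set has no dimension in this sense. *)
Definition has_dim S (k : nat) :=
  exists (p : E) (U : {vspace E}),
    [/\ S p, aff S = [set p + u | u in [set u | u \in U]] & \dim U = k].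

Definition relint S : set E :=
  [set x : E | S x /\ exists2 e : R, 0 < e &
     forall y, aff S y -> (forall i, `|y i - x i| < e) -> S y].

Definition polytope P := exists2 V : set E, finite_set V & P = conv V.

(* l = 0 gives the improper faces P and set0. *)
Definition face P Q := exists (l : E) (c : R),
  (forall x, P x -> \sum_i l i * x i <= c) /\
  Q = [set x : E | P x /\ \sum_i l i * x i = c].

Definition facet P Q :=
  face P Q /\ exists2 k, has_dim Q k & has_dim P k.+1.

Definition vertex P x := face P [set x].

(* Polytopal subdivisions of P without new vertices. *)
Definition subdivision P (Sigma : set (set E)) :=
  finite_set Sigma /\
  [/\ forall Q, Sigma Q -> polytope Q,
      forall Q Q', Sigma Q -> face Q Q' -> Sigma Q',
      forall Q Q', Sigma Q -> Sigma Q' ->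
        face Q (Q `&` Q') /\ face Q' (Q `&` Q'),
      \bigcup_(Q in Sigma) Q = P
    & forall Q x, Sigma Q -> vertex Q x -> vertex P x].

Definition maximal_cell (Sigma : set (set E)) Q :=
  Sigma Q /\ forall Q', Sigma Q' -> Q `<=` Q' -> Q' = Q.

(* H defines a split of P: P has a subdivision with exactly two maximal cells
   A and B, and A `&` B is a cell of codimension one whose affine span is cut
   out by H in the affine span of P.  P need not be full-dimensional, whence
   the intersection of H with aff P. *)
Definition defines_split P H :=
  exists (Sigma : set (set E)) (A B : set E),
    [/\ subdivision P Sigma, A <> B,
        forall Q, maximal_cell Sigma Q <-> Q = A \/ Q = B,
        exists2 k, has_dim (A `&` B) k & has_dim P k.+1
      & aff (A `&` B) = H `&` aff P].

Definition compatible P H H' := relint P `&` H `&` H' = set0.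

Definition cube : set E := [set x : E | forall i, 0 <= x i <= 1].

Definition hypersimplex (d : nat) : set E :=
  cube `&` [set x : E | \sum_i x i = d%:R :> R].

Variable M : matroid T.
Implicit Types (F G : {set T}).

Definition charvec (B : {set T}) : E := [ffun i => (i \in B)%:R].

Definition matroid_polytope : set E :=
  conv [set charvec B | B in [set B | basis M B]].

Definition flat_face F : set E :=
  matroid_polytope `&` [set x : E | \sum_(i in F) x i = (rank M F)%:R :> R].

Definition flacet F :=
  [/\ flat M F, facet matroid_polytope (flat_face F)
    & forall G, flat M G -> facet matroid_polytope (flat_face G) ->
        flat_face G = flat_face F -> G \subset F -> G = F].

Definition flat_hyperplane F : set E :=
  [set x : E | (rank M [set: T]%SET - rank M F)%:R * (\sum_(i in F) x i)
           = (rank M F)%:R * (\sum_(i in ~: F) x i) :> R].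

Definition split_flacet F :=
  flacet F /\
  defines_split (hypersimplex (rank M [set: T]%SET)) (flat_hyperplane F).

Definition split_matroid :=
  forall F G, split_flacet F -> split_flacet G -> F <> G ->
    compatible (aff matroid_polytope `&` cube)
      (flat_hyperplane F) (flat_hyperplane G).

Definition nonuniform_split_matroid := split_matroid /\ ~ uniform M.

End Polytopes.

Arguments split_matroid R {T} M.
Arguments nonuniform_split_matroid R {T} M.

(* Main.v *)
(** Write P(M) for the matroid polytope and r for the rank function.  The bases of M on the
    F-hyperplane are the bases of M|F + M/F, so the face of P(M) defined by F is again a matroid
    polytope; and the affine hull of P(M) is cut out by the equations x(S) = r(S), S ranging over
    the separators of M.  Comparing dimensions, a flat F defines a facet exactly when it cuts a
    single component C and M|(F :&: C) + (M|C)/(F :&: C) has no unexpected separators, and the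
    flacets of M are these sets F :&: C with the loops of M added.  The hyperplane of a flacet
    only involves coordinates in C and loops, which vanish on P(M). Hence hyperplanes of split
    flacets coming from different components meet in the relative interior, while those coming
    from the same component do so for M if and only if they do so for M|C. Finally a connected
    matroid has a split flacet whose hyperplane meets the relative interior if and only if it is
    not uniform. *)

Require Import Defs.
From HB Require Import structures.
From mathcomp Require Import boolp classical_sets cardinality.
From mathcomp Require Import all_boot all_order all_algebra reals.
From mathcomp Require Import zify ring lra.

Set Implicit Arguments.
Unset Strict Implicit.
Unset Printing Implicit Defensive.

(** * Rank, separators and components *)

(** No complete criterion for splits of a hypersimplex enters: the strict inequalities [r F < #|F|],
    [r F < r C] and [r C - r F < #|C :\: F|] are shown to produce a split, and they are in turn read
    off from incompatibility itself. A point of the relative interior has all its coordinates in a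
    component with at least two elements strictly between 0 and 1; if it also lies on the hyperplane
    of [F], summing over [F] and over [C :\: F] gives the inequalities. In a uniform matroid [r F]
    is [#|F|] or [r C], so they fail. Both directions thus become statements about [proper_facial]
    sets and common points, and such points can be glued from independent pieces on the components.
    The costly part of a split is the absence of new vertices. Both halves of the hypersimplex are
    shown to be convex hulls of 0/1 points, and faces of faces are then compared through their 0/1
    points. Loops and coloops are the singleton separators. Their coordinates are constant on the
    affine hull of P(M), so interior points are tested at the other elements only. *)

Section MatroidRank.
Variables (T : finType) (M : matroid T).
Implicit Types (A B C F G I J S : {set T}).
Local Notation r := (rank M).

Lemma leq_rank I A : I \subset A -> indep M I -> #|I| <= r A.
Proof.
by move=> IA hI; apply: (bigmax_sup I) => //; rewrite IA.
Qed.

Lemma rank_witness A : exists I, [/\ I \subset A, indep M I & #|I| = r A].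
Proof.
have h0 : (set0 \subset A) && indep M set0 by rewrite sub0set indep0.
have [|I /andP[IA hI] e] := @eq_bigmax_cond _
  [pred I : {set T} | (I \subset A) && indep M I] (fun I => #|I|).
  by apply/card_gt0P; exists set0.
by exists I; split=> //; rewrite /rank e.
Qed.

Lemma rank_card A : r A <= #|A|.
Proof. by have [I [IA _ <-]] := rank_witness A; apply: subset_leq_card. Qed.

Lemma rankS A B : A \subset B -> r A <= r B.
Proof.
have [I [IA hI <-]] := rank_witness A => AB.
by apply: leq_rank hI; apply: subset_trans AB.
Qed.

Lemma indep_card I : indep M I = (r I == #|I|).
Proof.
apply/idP/eqP => [hI|e]; first by apply/eqP; rewrite eqn_leq rank_card leq_rank.
have [J [JI hJ e']] := rank_witness I.
by suff <- : J = I by []; apply/eqP; rewrite eqEcard JI e' e /=.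
Qed.

Lemma rank0 : r set0 = 0.
Proof. by apply/eqP; rewrite -leqn0; have := rank_card set0; rewrite cards0. Qed.

Lemma indep_extend I A : indep M I -> I \subset A ->
  exists J, [/\ I \subset J, J \subset A, indep M J & #|J| = r A].
Proof.
move=> hI IA.
have [|J /maxsetP[/andP[JA hJ] maxJ] IJ] :=
  @maxset_exists _ (fun J => (J \subset A) && indep M J) I; first by rewrite IA.
exists J; split=> //; apply/eqP; rewrite eqn_leq leq_rank //=.
have [K [KA hK <-]] := rank_witness A; rewrite leqNgt; apply/negP => lt.
have [x /setDP[xK xJ] hx] := indep_exchange hJ hK lt.
have := maxJ (x |: J); rewrite subUset sub1set (subsetP KA) // JA hx => /(_ isT).
move/(_ (subsetUr _ _)) => e; by rewrite -e setU11 in xJ.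
Qed.

Lemma rank_submod A B : r (A :|: B) + r (A :&: B) <= r A + r B.
Proof.
have [I [IAB hI <-]] := rank_witness (A :&: B).
have [|J [IJ JAB hJ <-]] := indep_extend hI (_ : I \subset A :|: B).
  by apply: subset_trans IAB _; rewrite subIset // subsetUl.
have hA : #|J :&: A| <= r A.
  by apply: leq_rank; [exact: subsetIr | apply: indepS hJ; exact: subsetIl].
have hB : #|J :&: B| <= r B.
  by apply: leq_rank; [exact: subsetIr | apply: indepS hJ; exact: subsetIl].
have := cardsUI (J :&: A) (J :&: B).
rewrite -setIUr (setIidPl JAB) => e.
have : #|I| <= #|J :&: A :&: (J :&: B)|.
  by apply: subset_leq_card; rewrite setIACA setIid subsetI IJ.
lia.
Qed.

Lemma rankU A B : r (A :|: B) <= r A + r B.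
Proof. by have := rank_submod A B; lia. Qed.

Lemma basisE B : basis M B = indep M B && (#|B| == r [set: T]).
Proof.
apply/idP/andP => [/maxsetP[hB maxB]|[hB /eqP e]].
  split=> //; have [J [BJ _ hJ <-]] := indep_extend hB (subsetT B).
  by rewrite (maxB _ hJ BJ).
apply/maxsetP; split=> // J hJ BJ; apply/esym/eqP; rewrite eqEcard BJ e.
exact: leq_rank hJ.
Qed.

Lemma basis_witness : exists B, basis M B.
Proof.
have [B [_ hB e]] := rank_witness [set: T].
by exists B; rewrite basisE hB e /=.
Qed.

Lemma basis_extend I : indep M I -> exists2 B, basis M B & I \subset B.
Proof.
move=> hI; have [B [IB _ hB e]] := indep_extend hI (subsetT I).
by exists B => //; rewrite basisE hB e /=.
Qed.

(** If a maximal independent subset of [A] could be augmented from [A :|: X], the new element [x]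
    would make the rank of [x |: A] too large. *)
Lemma rank_closure A (X : {set T}) : (forall x, x \in X -> r (x |: A) = r A) -> r (A :|: X) = r A.
Proof.
move=> h; apply/eqP; rewrite eqn_leq [_ <= r (_ :|: _)]rankS ?subsetUl // andbT.
have [I [IA hI eI]] := rank_witness A; rewrite leqNgt; apply/negP.
have [J [JA hJ <-]] := rank_witness (A :|: X); rewrite -eI => lt.
have [x /setDP[xJ xI] hx] := indep_exchange hI hJ lt.
have le : #|x |: I| <= r (x |: A) by apply: leq_rank => //; exact: setUS.
move: le; rewrite cardsU1 xI; have := subsetP JA _ xJ; rewrite in_setU => /orP[xA|xX].
  by rewrite (setUidPr _) ?sub1set // -eI; lia.
by rewrite h // -eI; lia.
Qed.

(** Submodularity for [S], [A] and then for [S :|: A], [~: S] carries additivity from the full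
    ground set down to every [A]; the opposite inequality is subadditivity. *)
Lemma separator_leq S : r S + r (~: S) <= r [set: T] ->
  forall A, r A = r (A :&: S) + r (A :\: S).
Proof.
move=> le A; have h1 := rank_submod S A; have h2 := rank_submod (S :|: A) (~: S).
have h3 := rankU (A :&: S) (A :\: S); rewrite setID in h3.
have e1 : (S :|: A) :|: ~: S = [set: T].
  by apply/setP => x; rewrite !inE; case: (x \in S) => /=; rewrite ?orbT.
have e2 : (S :|: A) :&: ~: S = A :\: S.
  by apply/setP => x; rewrite !inE; case: (x \in S) => /=; rewrite ?andbF ?andbT ?orbF.
by rewrite e1 e2 in h2; rewrite (setIC S A) in h1; lia.
Qed.

Lemma separatorE S : separator M S = (r S + r (~: S) <= r [set: T]).
Proof.
apply/forallP/idP => [h|h I]; last first.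
  have := separator_leq h I; rewrite !indep_card.
  have := rank_card (I :&: S); have := rank_card (I :\: S).
  rewrite -(cardsID S I) => ? ? ?; apply/eqP; apply/idP/andP => [/eqP|[/eqP ? /eqP ?]]; last lia.
  by move=> ?; split; apply/eqP; lia.
have [I [IS hI <-]] := rank_witness S; have [J [JS hJ <-]] := rank_witness (~: S).
have JS' : [disjoint J & S] by rewrite disjoints_subset.
have e1 : (I :|: J) :&: S = I.
  rewrite setIUl (setIidPl IS).
  by move: JS'; rewrite -setI_eq0 => /eqP ->; rewrite setU0.
have e2 : (I :|: J) :\: S = J.
  rewrite setDUl; have /eqP -> : I :\: S == set0 by rewrite setD_eq0.
  by rewrite set0U; apply/setDidPl.
have hIJ : indep M (I :|: J) by rewrite (eqP (h _)) e1 e2 hI hJ.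
have := leq_rank (subsetT _) hIJ; rewrite cardsU.
have -> : I :&: J = set0; last by rewrite cards0; lia.
apply/eqP; rewrite setI_eq0; rewrite disjoint_sym; exact: disjointWr IS JS'.
Qed.

Lemma separator_rank S A : separator M S -> r A = r (A :&: S) + r (A :\: S).
Proof. by rewrite separatorE => /separator_leq ->. Qed.

Lemma separatorC S : separator M S = separator M (~: S).
Proof. by rewrite !separatorE setCK addnC. Qed.

Lemma separatorT : separator M [set: T].
Proof. by rewrite separatorE setCT rank0 addn0. Qed.

Lemma separatorI S S' : separator M S -> separator M S' -> separator M (S :&: S').
Proof.
move=> hS hS'; rewrite separatorE.
have := separator_rank [set: T] hS; rewrite setTI setTD.
have := separator_rank S hS'; have := separator_rank (~: (S :&: S')) hS.
have -> : ~: (S :&: S') :&: S = S :\: S'.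
  by apply/setP => x; rewrite !inE; do !case: (x \in _).
have -> : ~: (S :&: S') :\: S = ~: S.
  by apply/setP => x; rewrite !inE; do !case: (x \in _).
lia.
Qed.

Lemma separatorD S S' : separator M S -> separator M S' -> separator M (S :\: S').
Proof. by move=> hS hS'; rewrite setDE separatorI // -separatorC. Qed.

Lemma componentP C : reflect
  [/\ C != set0, separator M C & forall S, separator M S -> S \subset C ->
      S = set0 \/ S = C]
  (component M C).
Proof.
apply: (iffP minsetP) => [[/andP[C0 hC] minC]|[C0 hC minC]].
  split=> // S hS SC; have [->|S0] := eqVneq S set0; first by left.
  by right; apply: minC; rewrite ?S0.
split; first by rewrite C0.
by move=> S /andP[S0 hS] SC; have [e|//] := minC S hS SC; rewrite e eqxx in S0.
Qed.

Lemma component_separator C S : component M C -> separator M S ->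
  C \subset S \/ [disjoint C & S].
Proof.
move=> /componentP[_ hC minC] hS.
have [|e|e] := minC (C :&: S) (separatorI hC hS); first exact: subsetIl.
  by right; rewrite -setI_eq0 e.
by left; apply/setIidPl.
Qed.

Lemma component_disjoint C D : component M C -> component M D -> C != D ->
  [disjoint C & D].
Proof.
move=> hC hD; have /componentP[_ sD minD] := hD.
have [CD|//] := component_separator hC sD.
have /componentP[C0 sC _] := hC.
have [e|->] := minD C sC CD; last by rewrite eqxx.
by rewrite e eqxx in C0.
Qed.

(** Augment [B :&: Z] by some [y] of [Z] and complete it inside [y |: B]: the completion omits
    exactly one element [x] of [B], which is outside [Z] because [B :&: Z] is kept. *)
Lemma exchange_basis B Z : basis M B -> #|B :&: Z| < r Z ->
  exists x y, [/\ x \in B :\: Z, y \in Z :\: B & basis M (y |: (B :\ x))].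
Proof.
move=> hB lt; have [J [JZ hJ eJ]] := rank_witness Z.
move: (hB); rewrite basisE => /andP[iB /eqP cB].
have iBZ : indep M (B :&: Z) by apply: indepS iB; exact: subsetIl.
rewrite -eJ in lt; have [y /setDP[yJ yBZ] hy] := indep_exchange iBZ hJ lt.
have yZ := subsetP JZ _ yJ; have yB : y \notin B by apply: contra yBZ; rewrite inE yZ andbT.
have [|K [IK KB hK eK]] := indep_extend hy (_ : y |: (B :&: Z) \subset y |: B).
  by apply: setUS; exact: subsetIl.
have e : r (y |: B) = #|B|.
  by apply/eqP; rewrite eqn_leq cB rankS ?subsetT //= -cB leq_rank // subsetUr.
have KnB : ~~ (B \subset K).
  apply/negP => BK.
  suff : y |: B \subset K by move/subset_leq_card; rewrite cardsU1 yB eK e ltnn.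
  by rewrite subUset BK (subset_trans _ IK) // subsetUl.
have [x xB xK] := subsetPn KnB.
have yK : y \in K by apply: (subsetP IK); rewrite setU11.
have eKB : K = y |: (B :\ x).
  apply/eqP; rewrite eqEcard; apply/andP; split.
    apply/subsetP => z zK; have := subsetP KB _ zK; rewrite !inE.
    by case: eqP => //= _ ->; rewrite andbT; apply: contra xK => /eqP <-.
  by rewrite cardsU1 !inE (negPf yB) andbF /= eK e (cardsD1 x B) xB.
exists x, y; split.
- rewrite inE xB andbT; apply: contra xK => xZ; apply: (subsetP IK).
  by rewrite !inE xB xZ orbT.
- by rewrite inE yB.
- by rewrite -eKB basisE hK eK e cB /=.
Qed.

Definition loops := [set x | r [set x] == 0].

Lemma rank_loops : r loops = 0.
Proof.
rewrite -(set0U loops) rank_closure ?rank0 // => x; rewrite inE setU0.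
by move/eqP.
Qed.

Lemma flatP F : reflect (forall x, x \notin F -> r F < r (x |: F)) (flat M F).
Proof. by apply: (iffP forallP) => h x; have := h x; move/implyP; apply. Qed.

Lemma flat_loops F : flat M F -> loops \subset F.
Proof.
move/flatP=> h; apply/subsetP => x; rewrite inE => /eqP xl.
by apply: contraT => /h; have := rankU [set x] F; lia.
Qed.

(** The two alternatives say that [x] is a loop or a coloop. *)
Lemma separator1 x : separator M [set x] = (r [set x] == 0) || (r (~: [set x]) < r [set: T]).
Proof.
rewrite separatorE; have := rank_card [set x]; rewrite cards1.
have := rankU [set x] (~: [set x]); rewrite setUCr.
have := rankS (subsetT (~: [set x])).
lia.
Qed.

Lemma component_nosep1 C x : component M C -> 1 < #|C| -> x \in C -> ~~ separator M [set x].
Proof.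
move=> /componentP[_ _ minC] C1 xC; apply/negP => /minC [|e|e].
- by rewrite sub1set.
- by have := cards1 x; rewrite e cards0.
- by move: C1; rewrite -e cards1.
Qed.

Lemma component_loops C : component M C -> 1 < #|C| -> [disjoint C & loops].
Proof.
move=> hC C1; rewrite disjoint_subset; apply/subsetP => x xC.
have := component_nosep1 hC C1 xC; rewrite separator1 negb_or => /andP[+ _].
by rewrite !inE.
Qed.

Lemma uniform_rank A : uniform M -> r A = minn #|A| (r [set: T]).
Proof.
move=> u; apply/eqP; rewrite eqn_leq leq_min rank_card rankS ?subsetT //=.
(* Such an [I] is padded to a set with exactly as many elements as the rank, which uniformity makes
   a basis. *)
have h (I : {set T}) : #|I| <= r [set: T] -> indep M I.
  move=> le; have [J IJ /eqP cJ] : exists2 J : {set T}, I \subset J & #|J| == r [set: T].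
    have := rank_card [set: T]; have := cardsC I; rewrite -cardsT => cI lT.
    have [K KI cK] : exists2 K : {set T}, K \subset ~: I & #|K| = r [set: T] - #|I|.
      have : r [set: T] - #|I| <= #|~: I| by lia.
      by move/card_geqP => [s [us es ss]]; exists [set x in s];
        [apply/subsetP => x; rewrite inE => /ss | rewrite cardsE (card_uniqP us)].
    exists (I :|: K); first exact: subsetUl.
    rewrite cardsU cK; have -> : I :&: K = set0.
      by apply/eqP; rewrite setI_eq0 disjoint_sym disjoints_subset.
    by rewrite cards0; apply/eqP; lia.
  have : basis M J by rewrite u cJ /=.
  by rewrite basisE => /andP[+ _]; apply: indepS.
have [I IA cI] : exists2 I : {set T}, I \subset A & #|I| = minn #|A| (r [set: T]).
  have : minn #|A| (r [set: T]) <= #|A| by lia.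
  by move/card_geqP => [s [us es ss]]; exists [set x in s];
    [apply/subsetP => x; rewrite inE => /ss | rewrite cardsE (card_uniqP us)].
by rewrite -cI; apply: leq_rank => //; apply: h; rewrite cI; lia.
Qed.

Lemma rank_uniform : (forall A, r A = minn #|A| (r [set: T])) -> uniform M.
Proof.
move=> h B; rewrite basisE indep_card h.
by apply/idP/idP; lia.
Qed.

End MatroidRank.

(** * Faces of the matroid polytope as direct sums M|F + M/F *)

Section FaceMatroid.
Variables (T : finType) (M : matroid T) (F : {set T}).
Implicit Types (A B C G I J S : {set T}).
Local Notation r := (rank M).

(** The second condition is independence of [I :\: F] in the contraction of [F], expressed through
    ranks of [M]. *)
Definition findep : pred {set T} :=
  fun I => indep M (I :&: F) && (r (F :|: I) == r F + #|I :\: F|).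

Fact findep0 : findep set0.
Proof. by rewrite /findep set0I set0D setU0 indep0 cards0 addn0 /=. Qed.

Fact findepS I J : I \subset J -> findep J -> findep I.
Proof.
move=> IJ /andP[hJ /eqP e]; rewrite /findep (indepS _ hJ) ?setSI //=.
have e1 : F :|: J = (F :|: I) :|: (J :\: F :\: I).
  apply/setP => x; rewrite !inE; have := subsetP IJ x.
  by case: (x \in I) => [->|_] //=; case: (x \in J); case: (x \in F).
have h1 := rankU M (F :|: I) (J :\: F :\: I); rewrite -e1 e in h1.
have h2 := rank_card M (J :\: F :\: I).
have e2 : F :|: I :\: F = F :|: I by apply/setP => x; rewrite !inE; case: (x \in F).
have h3 := rankU M F (I :\: F); rewrite e2 in h3.
have := cardsID I (J :\: F); rewrite setIDAC (setIidPr IJ) => h4.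
have h5 := rank_card M (I :\: F).
by apply/eqP; lia.
Qed.

Fact findep_exchange I J : findep I -> findep J -> #|I| < #|J| ->
  exists2 x, x \in J :\: I & findep (x |: I).
Proof.
move=> /andP[hI /eqP eI] /andP[hJ /eqP eJ] lt.
(* Either [J] is larger than [I] inside [F], and the exchange takes place in the restriction to [F],
   or it is larger outside, and some element of [J] raises the rank of [F :|: I]. *)
have [lt1|ge1] := ltnP #|I :&: F| #|J :&: F|.
  have [x /setDP[/setIP[xJ xF] xI] hx] := indep_exchange hI hJ lt1.
  exists x; first by move: xI; rewrite !inE xF andbT xJ andbT.
  rewrite /findep; have -> : (x |: I) :&: F = x |: (I :&: F).
    by rewrite setIUl (setIidPl _) ?sub1set.
  have -> : F :|: (x |: I) = F :|: I.
    by rewrite setUCA setUA; congr (_ :|: _); apply/setUidPr; rewrite sub1set.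
  have -> : (x |: I) :\: F = I :\: F.
    by rewrite setDUl; have /eqP -> : [set x] :\: F == set0; rewrite ?set0U // setD_eq0 sub1set.
  by rewrite hx eI eqxx.
have lt2 : r (F :|: I) < r (F :|: J).
  by rewrite eI eJ; have := cardsID F I; have := cardsID F J; lia.
have [x xJ hx] : exists2 x, x \in J & r (x |: (F :|: I)) != r (F :|: I).
  apply/exists_inP; apply: contraLR lt2; rewrite negb_exists_in -leqNgt => /forall_inP h.
  rewrite -(@rank_closure _ M (F :|: I) J) => [|x xJ].
    by apply: rankS; rewrite setUAC subsetUl.
  by apply/eqP; rewrite -[_ == _]negbK h.
have xFI : x \notin F :|: I.
  by apply: contra hx => xFI; rewrite (setUidPr _) ?sub1set.
move: (xFI); rewrite inE negb_or => /andP[xF xI].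
have hx' : r (x |: (F :|: I)) = (r (F :|: I)).+1.
  have := rankU M [set x] (F :|: I); have := rank_card M [set x]; rewrite cards1.
  have := rankS M (subsetUr [set x] (F :|: I)); move: hx; lia.
exists x; first by rewrite inE xI.
rewrite /findep setIUl; have -> : [set x] :&: F = set0.
  by apply/eqP; rewrite setI_eq0 disjoints1.
rewrite set0U hI setUCA hx' eI setDUl.
have -> : [set x] :\: F = [set x] by apply/setDidPl; rewrite disjoints1.
by rewrite cardsU1 inE (negPf xI) andbF /= addnCA add1n.
Qed.

(* The direct sum of the restriction of M to F and of the contraction M / F; its bases are
   the bases of M lying on the face of F. *)
Definition face_matroid : matroid T := Matroid findep0 findepS findep_exchange.

(** The direct sum formula with [r F] moved to the left, away from truncated subtraction. For the
    lower bound, a maximal independent subset of [A :&: F] is joined to [K :\: F], where [K] extends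
    a maximal independent subset of [F] inside [F :|: A]. *)
Lemma rank_face A : rank face_matroid A + r F = r (A :&: F) + r (F :|: A).
Proof.
apply/eqP; rewrite eqn_leq; apply/andP; split.
  have [I [IA /andP[hI /eqP eI] <-]] := rank_witness face_matroid A.
  have h1 : #|I :&: F| <= r (A :&: F) by apply: leq_rank hI; exact: setSI.
  have h2 : r (F :|: I) <= r (F :|: A) by apply: rankS; exact: setUS.
  by have := cardsID F I; lia.
have [J [JA hJ eJ]] := rank_witness M (A :&: F).
have [J0 [J0F hJ0 eJ0]] := rank_witness M F.
have [|K [JK KA hK eK]] := indep_extend hJ0 (_ : J0 \subset F :|: A).
  by apply: subset_trans J0F _; exact: subsetUl.
have KF : #|K :&: F| <= r F.
  by apply: leq_rank; [exact: subsetIr | apply: indepS hK; exact: subsetIl].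
have [JA' JF] : J \subset A /\ J \subset F by move: JA; rewrite subsetI => /andP[].
have e1 : (J :|: K :\: F) :&: F = J.
  by rewrite setIUl (setIidPl JF) setIDAC setDIl setDv setI0 setU0.
have e2 : (J :|: K :\: F) :\: F = K :\: F.
  by rewrite setDUl; have /eqP -> : J :\: F == set0; rewrite ?setD_eq0 // set0U setDDl setUid.
have KFr : r (F :|: K) = r F + #|K :\: F|.
  have h := rankU M F (K :\: F); have := rank_card M (K :\: F).
  have e : F :|: K :\: F = F :|: K.
    by apply/setP => x; rewrite !inE; case: (x \in F).
  rewrite e in h; have : #|K| <= r (F :|: K) by apply: leq_rank => //; exact: subsetUr.
  have : #|J0| <= #|K :&: F| by apply: subset_leq_card; rewrite subsetI JK.
  by have := cardsID F K; move: h eJ0 eK KF; clear; lia.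
have hI : indep face_matroid (J :|: K :\: F).
  rewrite /= /findep e1 e2 hJ /= -KFr; apply/eqP; congr r.
  by apply/setP => x; rewrite !inE; have := subsetP JF x; case: (x \in J) => [->|_];
    case: (x \in F).
have : #|J :|: K :\: F| <= rank face_matroid A.
  apply: leq_rank hI; rewrite subUset JA' /=; apply/subsetP => x /setDP[xK xF].
  by have := subsetP KA x xK; rewrite inE (negPf xF).
have : #|J0| <= #|K :&: F| by apply: subset_leq_card; rewrite subsetI JK.
have := cardsID F (J :|: K :\: F); rewrite e1 e2; have := cardsID F K.
by move: eJ eJ0 eK KF; clear; lia.
Qed.

Lemma rank_faceT : rank face_matroid [set: T] = r [set: T].
Proof. by have := rank_face [set: T]; rewrite setTI setUT; lia. Qed.

Lemma basis_face B : basis face_matroid B = basis M B && (#|B :&: F| == r F).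
Proof.
rewrite !basisE rank_faceT /= /findep; apply/idP/idP.
  move=> /andP[/andP[hB /eqP e] /eqP cB]; rewrite cB eqxx andbT.
  have h1 := rankS M (subsetT (F :|: B)); have h2 := cardsID F B.
  move: (hB); rewrite indep_card => /eqP h3.
  have h4 := rankS M (subsetIr B F); have h5 := rank_submod M F B.
  rewrite (setIC F B) in h5; have h6 := rank_card M B.
  by rewrite indep_card; apply/andP; split; apply/eqP; lia.
move=> /andP[/andP[hB /eqP cB] /eqP e]; rewrite cB eqxx andbT.
rewrite (indepS _ hB) ?subsetIl //=; have := rankS M (subsetT (F :|: B)).
have : #|B| <= r (F :|: B) by apply: leq_rank hB; exact: subsetUr.
by have := cardsID F B; move=> *; apply/eqP; lia.
Qed.

Lemma separator_face S : separator face_matroid S =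
  (r (S :&: F) + r (F :\: S) + (r (F :|: S) + r (F :|: ~: S)) <= r [set: T] + r F + r F).
Proof.
rewrite separatorE rank_faceT; have := rank_face S; have := rank_face (~: S).
by rewrite setIC -setDE => h1 h2; apply/idP/idP; lia.
Qed.

End FaceMatroid.

(** * Facial sets and their existence in connected non-uniform matroids *)

Section Facial.
Variables (T : finType) (M : matroid T).
Implicit Types (A B C F G I J S X Y Z : {set T}).
Local Notation r := (rank M).

(* F is a nonempty proper flat of M|C such that the only nontrivial separators of
   M|F + (M|C)/F are F and its complement in C. *)
Definition facial C F :=
  [/\ F \subset C, F != set0, F != C, forall x, x \in C -> x \notin F -> r F < r (x |: F)
    & forall S, S \subset C -> r (S :&: F) + r (F :\: S) <= r F ->
        r (F :|: S) + r (F :|: C :\: S) <= r F + r C ->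
        S \in [:: set0; F; C :\: F; C]].

(** The argument of [separator_leq] relative to [G]. *)
Lemma modular_sub Y G Z : Y \subset G -> r Y + r (G :\: Y) <= r G -> Z \subset G ->
  r (Z :&: Y) + r (Z :\: Y) <= r Z.
Proof.
move=> YG le ZG; have h1 := rank_submod M Y Z; have h2 := rank_submod M (Y :|: Z) (G :\: Y).
have e1 : (Y :|: Z) :|: (G :\: Y) = G.
  apply/setP => x; rewrite !inE; have := subsetP YG x; have := subsetP ZG x.
  by case: (x \in G); case: (x \in Y); case: (x \in Z) => // h h'; 
    rewrite ?(h isT) ?(h' isT) //; by [have := h isT | have := h' isT].
have e2 : (Y :|: Z) :&: (G :\: Y) = Z :\: Y.
  apply/setP => x; rewrite !inE; have := subsetP ZG x.
  by case: (x \in Y); case: (x \in Z) => //= h; rewrite ?h ?andbF.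
by rewrite e1 e2 in h2; rewrite (setIC Y Z) in h1; lia.
Qed.

(** Connectedness of [M|F] in terms of ranks, boolean so that [maxset] can range over connected
    flats. *)
Let conn F := [forall Y : {set T}, (Y \subset F) && (r Y + r (F :\: Y) <= r F) ==>
  ((Y == set0) || (Y == F))].

Let connP F : reflect (forall Y, Y \subset F -> r Y + r (F :\: Y) <= r F -> Y = set0 \/ Y = F)
  (conn F).
Proof.
apply: (iffP forallP) => h Y.
  move=> YF le; have := h Y; rewrite YF le /= => /orP[/eqP|/eqP]; [by left | by right].
by apply/implyP => /andP[YF le]; have [->|->] := h Y YF le; rewrite eqxx ?orbT.
Qed.

Hypothesis Mconn : component M [set: T].

Let sepT S : separator M S -> S = set0 \/ S = [set: T].
Proof. by move=> hS; have /componentP[_ _ h] := Mconn; apply: h. Qed.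

(* The closure of a circuit of rank smaller than that of M. *)
Lemma connected_flat_exists : ~ uniform M -> exists F,
  [&& flat M F, 1 < #|F|, conn F & r F < r [set: T]].
Proof.
move=> nu; have [A hA] : exists A, r A != minn #|A| (r [set: T]).
  apply/existsP; apply: contraT; rewrite negb_exists => /forallP h.
  by case: nu; apply: rank_uniform => A; apply/eqP; have := h A; rewrite negbK.
have rA1 := rank_card M A; have rA2 := rankS M (subsetT A).
have T1 : 1 < #|T|.
  rewrite ltnNge; apply/negP => T1; move: hA; rewrite -cardsT in T1.
  have : #|A| <= 1 by apply: leq_trans T1; exact/subset_leq_card/subsetT.
  case: (posnP #|A|) => [/eqP|A0 A1].
    by rewrite cards_eq0 => /eqP ->; rewrite rank0 cards0 min0n.
  have -> : A = [set: T] by apply/eqP; rewrite eqEcard subsetT; lia.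
  by have := rank_card M [set: T]; lia.
have noloop x : 0 < r [set x].
  rewrite lt0n; apply/negP => /eqP h.
  have := component_nosep1 Mconn; rewrite cardsT => /(_ x T1 (in_setT _)).
  by rewrite separator1 h eqxx.
have [J [JA hJ cJ]] := rank_witness M A.
have [x xA xJ] : exists2 x, x \in A & x \notin J.
  by apply/subsetPn; apply/negP => /subset_leq_card; move: hA rA1 rA2; lia.
(* [J] is a maximal independent subset of [A], so [x |: J] contains a circuit [K], with at most
   [r A + 1] elements. *)
have [|K /minsetP[dK minK] KJ] := @minset_exists _ (fun K => ~~ indep M K) (x |: J).
  apply/negP => hx; have := leq_rank (_ : x |: J \subset A) hx.
  by rewrite subUset sub1set xA JA cardsU1 xJ => /(_ isT); lia.
have cK : #|K| <= (r A).+1 by move/subset_leq_card: KJ; rewrite cardsU1 xJ cJ.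
have iK Y : Y \proper K -> r Y = #|Y|.
  move=> /andP[YK nKY]; apply/eqP; rewrite -indep_card; apply: contraNT nKY => dY.
  by rewrite (minK Y).
have rK : (r K).+1 = #|K|.
  have [y yK] : exists y, y \in K.
    by apply/set0Pn; apply: contra dK => /eqP ->; rewrite indep0.
  have := iK (K :\ y) (properD1 yK); have := rankS M (subD1set K y).
  by have := rank_card M K; move: dK; rewrite indep_card (cardsD1 y K) yK; clear; lia.
pose F := [set x | r (x |: K) == r K].
have KF : K \subset F by apply/subsetP => y yK; rewrite inE (setUidPr _) ?sub1set.
have rF : r F = r K.
  rewrite -(setUidPr KF); apply: rank_closure => y; rewrite inE; exact/eqP.
exists F; apply/and4P; split.
- apply/flatP => y; rewrite inE rF => h; have := rankS M (setUS [set y] KF).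
  by have := rankS M (subsetUr [set y] K); move: h; clear; lia.
- have := subset_leq_card KF; have : 0 < r K.
    have [y yK] : exists y, y \in K.
      by apply/set0Pn; apply: contra dK => /eqP ->; rewrite indep0.
    by apply: leq_trans (noloop y) _; apply: rankS; rewrite sub1set.
  by move: rK; clear; lia.
- apply/connP => Y YF le.
  have h0 Z : r Z = 0 -> Z = set0.
    move=> rZ; apply/eqP; apply: contraT => /set0Pn[y yZ].
    have := noloop y; have : r [set y] <= r Z by apply: rankS; rewrite sub1set.
    by rewrite rZ; clear; lia.
  (* If one part contains the circuit, the other has rank 0 and is empty for lack of loops.
     Otherwise both traces on [K] are independent, and additivity would make [K] independent. *)
  have hK := modular_sub YF le KF.
  have [KY|nKY] := boolP (K \subset Y).
    right; apply/eqP; rewrite eqEsubset YF -setD_eq0; apply/eqP/h0.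
    by have := rankS M KY; move: le rF; clear; lia.
  have [KY|nKY'] := boolP (K \subset F :\: Y).
    by left; apply: h0; have := rankS M KY; move: le rF; clear; lia.
  have p1 : K :&: Y \proper K by rewrite properE subsetIl subsetI subxx.
  have p2 : K :\: Y \proper K.
    rewrite properE subsetDl; apply: contra nKY' => h.
    by apply: subset_trans h _; exact: setSD.
  by have := cardsID Y K; rewrite -(iK _ p1) -(iK _ p2); move: hK rK; clear; lia.
- by rewrite rF; move: hA rA1 rA2 cJ cK rK; clear; lia.
Qed.

(* Take F maximal among the proper flats with at least two elements for which M|F is
   connected.  If S were a nontrivial separator of M/F, then the flat F :|: S would be proper
   and larger, and a separator of M|(F :|: S) avoiding F would already separate M, so that
   M|(F :|: S) would be connected. *)
Lemma facial_exists : ~ uniform M -> exists F,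
  [/\ facial [set: T] F, r F < #|F|, r F < r [set: T] & r [set: T] - r F < #|~: F|].
Proof.
move=> nu; have [F0 hF0] := connected_flat_exists nu.
have [F /maxsetP[/and4P[fF F1 cF rF] maxF] _] := 
  @maxset_exists _ (fun F => [&& flat M F, 1 < #|F|, conn F & r F < r [set: T]]) F0 hF0.
have T1 : 1 < #|T| by apply: leq_trans F1 (max_card _).
have FT : F != [set: T] by apply: contraTneq rF => ->; rewrite ltnn.
have F0' : F != set0 by apply: contraTneq F1 => ->; rewrite cards0.
have fl x := flatP _ _ fF x.
exists F; split=> //; last first.
(* No element is a coloop, so [F] and [~: F] without one element still reach full rank. *)
- have [x xF] : exists x, x \in ~: F.
    by apply/set0Pn; apply: contra FT => /eqP e; rewrite -(setCK F) e setC0.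
  have := component_nosep1 Mconn; rewrite cardsT => /(_ x T1 (in_setT _)).
  rewrite separator1 negb_or -leqNgt => /andP[_ h].
  have e : ~: [set x] = F :|: (~: F :\ x).
    apply/setP => y; rewrite !inE; case: eqP => [->|_] /=; last by rewrite orbN.
    by move: xF; rewrite inE => /negPf ->.
  have := rankU M F (~: F :\ x); rewrite -e; have := rank_card M (~: F :\ x).
  by have := cardsD1 x (~: F); rewrite xF; move: h rF; clear; lia.
(* Were [F] independent, each of its elements would separate [M|F]. *)
- rewrite ltn_neqAle rank_card andbT; apply/eqP => e.
  have [x xF] : exists x, x \in F by apply/set0Pn.
  have /connP /(_ [set x]) := cF; rewrite sub1set => /(_ xF) [|h|h].
  + have := rank_card M (F :\ x); have := rank_card M [set x]; rewrite cards1 e.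
    by rewrite (cardsD1 x F) xF; clear; lia.
  + by have := cards1 x; rewrite h cards0.
  + by move: F1; rewrite -h cards1.
split=> // [x _|]; first exact: fl.
move=> S _; rewrite setTD => le1 le2.
have hF : S :&: F = set0 \/ S :&: F = F.
  have /connP := cF; apply; first exact: subsetIr.
  by rewrite setDIr setDv setU0.
have hC : S \subset F \/ ~: S \subset F.
  apply/orP; apply: contraT; rewrite negb_or => /andP[/subsetPn[y yS yF] /subsetPn[z zS zF]].
  have zS' : z \notin S by move: zS; rewrite inE.
  have eU : (F :|: S) :|: (F :|: ~: S) = setT.
    by apply/setP => x; rewrite !inE; case: (x \in S); rewrite ?orbT.
  (* Flatness of [F :|: S]: the element [x] raises the rank of [F], and as [S] separates the
     contraction of [F], submodularity against [F :|: ~: S] carries this increase over. *)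
  have gl x : x \notin F :|: S -> r (F :|: S) < r (x |: (F :|: S)).
    rewrite inE negb_or => /andP[xF xS]; have := rank_submod M (x |: (F :|: S)) (F :|: ~: S).
    rewrite -setUA eU setUT; have -> : (x |: (F :|: S)) :&: (F :|: ~: S) = x |: F.
      apply/setP => w; rewrite !inE; case: eqP => [->|_] /=; first by rewrite xS orbT.
      by case: (w \in F); case: (w \in S).
    by have := fl x xF; move: le2; clear; lia.
  have FG : F \subset F :|: S by exact: subsetUl.
  suff /maxF : [&& flat M (F :|: S), 1 < #|F :|: S|, conn (F :|: S) & r (F :|: S) < r setT].
    by move=> /(_ FG) /setP/(_ y); rewrite inE yS orbT (negPf yF).
  apply/and4P; split.
  - exact/flatP.
  - by apply: leq_trans F1 _; exact: subset_leq_card.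
  - have aux X Y : Y \subset F :|: S -> F \subset X -> Y :&: F = set0 -> X \subset F :|: S ->
       ~: Y \subset X :|: ~: S -> r Y + r X <= r (F :|: S) -> Y = set0.
      move=> YG FX YF XG YX le.
      have : separator M Y.
        rewrite separatorE; have := rankS M (subset_trans YX (_ : _ \subset X :|: (F :|: ~: S))).
        move=> /(_ (setUS _ (subsetUr _ _))).
        have := rank_submod M X (F :|: ~: S).
        have : r F <= r (X :&: (F :|: ~: S)) by apply: rankS; rewrite subsetI FX subsetUl.
        by move: le2 le; clear; lia.
      move/sepT => [//|e]; move: YF; rewrite e setTI => e'; by rewrite e' eqxx in F0'.
    apply/connP => Y YG le; have := modular_sub YG le FG => le'.
    have /connP /(_ (F :&: Y)) := cF; rewrite subsetIl setDIr setDv set0U.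
    case=> // [e|/setIidPl FY].
      left; apply: (aux ((F :|: S) :\: Y)) => //; rewrite ?(setIC Y) ?subsetDl //.
        by rewrite subsetD FG -setI_eq0 e /=.
      by apply/subsetP => x; rewrite !inE => /negPf ->; case: (x \in S); rewrite ?orbT.
    right; apply/eqP; rewrite eqEsubset YG -setD_eq0; apply/eqP.
    apply: (aux Y) => //; rewrite ?subsetDl //.
    + by rewrite setIDAC (setIidPr FG); apply/eqP; rewrite setD_eq0.
    + by apply/subsetP => x; rewrite !inE; case: (x \in Y); case: (x \in S); rewrite ?orbT.
    + by rewrite addnC.
  - by apply: leq_trans (gl z _) (rankS M (subsetT _)); rewrite inE negb_or zF.
rewrite !inE; case: hF => [e|e]; case: hC => h.
- by rewrite -e (setIidPl h) eqxx.
- suff -> : S = ~: F by rewrite setTD eqxx !orbT.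
  apply/eqP; rewrite eqEsubset -disjoints_subset -setI_eq0 e eqxx /=.
  by rewrite -(setCK S) setCS.
- suff -> : S = F by rewrite eqxx !orbT.
  by rewrite -e; apply/esym/setIidPl.
- suff -> : S = setT by rewrite eqxx !orbT.
  have FS : F \subset S by rewrite -e subsetIl.
  by apply/eqP; rewrite -subTset -(setUCr S) subUset subxx (subset_trans h FS).
Qed.

End Facial.

(** * Transport between a restriction and the ambient matroid *)

Section Restrict.
Variables (T : finType) (M : matroid T) (C : {set T}).
Local Notation N := (restrict M C).
Local Notation sT := {x : T | x \in C}.
Implicit Types (A B F S : {set sT}).

Lemma val_imsetT : val @: [set: sT] = C.
Proof.
apply/setP => x; apply/imsetP/idP => [[y _ ->]|xC]; first exact: valP.
by exists (Sub x xC) => //; rewrite SubK.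
Qed.

Lemma val_imsetS A : val @: A \subset C.
Proof. by apply/subsetP => x /imsetP[y _ ->]; exact: valP. Qed.

Lemma val_preimsetK (S : {set T}) : S \subset C -> val @: (val @^-1: S : {set sT}) = S.
Proof.
move=> SC; apply/setP => x; apply/imsetP/idP => [[y]|xS]; first by rewrite inE => ? ->.
by exists (Sub x (subsetP SC x xS)); rewrite ?inE SubK.
Qed.

Lemma val_imset_inj : injective (fun A => val @: A : {set T}).
Proof. exact/imset_inj/val_inj. Qed.

Lemma val_imsetD A B : val @: (A :\: B) = (val @: A) :\: (val @: B) :> {set T}.
Proof.
apply/setP => x; rewrite inE; apply/imsetP/andP => [[y /setDP[yA yB] ->]|[xB /imsetP[y yA e]]].
  by split; [rewrite mem_imset //; exact: val_inj | exact: imset_f].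
by exists y => //; rewrite inE yA andbT; apply: contra xB => yB; rewrite e; exact: imset_f.
Qed.

Lemma val_imsetI A B : val @: (A :&: B) = (val @: A) :&: (val @: B) :> {set T}.
Proof. by apply: imsetI => x y _ _; exact: val_inj. Qed.

Lemma rank_restrict A : rank N A = rank M (val @: A).
Proof.
apply/eqP; rewrite eqn_leq; apply/andP; split.
  have [I [IA hI <-]] := rank_witness N A.
  by rewrite -(card_imset _ val_inj); apply: leq_rank => //; exact: imsetS.
have [J [JA hJ <-]] := rank_witness M (val @: A).
have JC : J \subset C := subset_trans JA (val_imsetS A).
rewrite -(val_preimsetK JC) (card_imset _ val_inj); apply: leq_rank.
  by apply/subsetP => x; rewrite inE => /(subsetP JA); rewrite mem_imset //; exact: val_inj.
by rewrite /= val_preimsetK.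
Qed.

Lemma rank_restrictT : rank N [set: sT] = rank M C.
Proof. by rewrite rank_restrict val_imsetT. Qed.

Lemma val_imsetC A : val @: (~: A) = C :\: val @: A.
Proof. by rewrite -setTD val_imsetD val_imsetT. Qed.

Lemma card_restrict : #|{: sT}| = #|C|.
Proof. by rewrite -cardsT -(card_imset _ val_inj) val_imsetT. Qed.

Lemma separator_restrict S : separator M C -> separator N S = separator M (val @: S).
Proof.
move=> hC; rewrite !separatorE !rank_restrict val_imsetT val_imsetC.
have := separator_rank [set: T] hC; rewrite setTI setTD => ->.
rewrite (separator_rank (~: val @: S) hC).
have -> : ~: val @: S :&: C = C :\: val @: S by rewrite setIC setDE.
have -> : ~: val @: S :\: C = ~: C.
  apply/setP => x; rewrite !inE; have := subsetP (val_imsetS S) x.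
  by case: (x \in val @: S) => [->|] //; rewrite andbT.
by apply/idP/idP; lia.
Qed.

Lemma component_restrict : component M C -> component N [set: sT].
Proof.
move=> /componentP[C0 hC minC]; apply/componentP; split.
- by apply: contra C0 => /eqP e; move: val_imsetT; rewrite e imset0 => <-.
- exact: separatorT.
- move=> S; rewrite separator_restrict // => /minC /(_ (val_imsetS S))[|] e; [left|right].
    by apply: val_imset_inj; rewrite e imset0.
  by apply: val_imset_inj; rewrite e val_imsetT.
Qed.

Lemma facial_restrict F : facial N [set: sT] F <-> facial M C (val @: F).
Proof.
have inj := val_imset_inj; split=> [[_ F0 FT fl pr]|[_ F0 FT fl pr]].
  split.
  - exact: val_imsetS.
  - by apply: contra F0 => /eqP e; apply/eqP/inj; rewrite e imset0.
  - by apply: contra FT => /eqP e; apply/eqP/inj; rewrite val_imsetT.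
  - move=> x xC xF; have := fl (Sub x xC) (in_setT _); rewrite !rank_restrict imsetU1 SubK.
    by apply; apply: contra xF => /(imset_f val); rewrite SubK.
  - move=> S SC; rewrite -(val_preimsetK SC) -val_imsetI -!val_imsetD -imsetU.
    rewrite -val_imsetC -imsetU -rank_restrictT -!rank_restrict -setTD => h1 h2.
    have := pr _ (subsetT _) h1 h2; rewrite !inE => /or4P[] /eqP ->.
    + by rewrite imset0 eqxx.
    + by rewrite eqxx orbT.
    + by rewrite setTD val_imsetC eqxx !orbT.
    + by rewrite val_imsetT eqxx !orbT.
split.
- exact: subsetT.
- by apply: contra F0 => /eqP ->; rewrite imset0.
- by apply: contra FT => /eqP ->; rewrite val_imsetT.
- move=> x _ xF; rewrite !rank_restrict imsetU1; apply: fl; first exact: valP.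
  by rewrite mem_imset //; exact: val_inj.
- move=> S _; rewrite !rank_restrict val_imsetI val_imsetD !imsetU val_imsetD val_imsetT => h1 h2.
  have := pr _ (val_imsetS S) h1 h2; rewrite -val_imsetC setTD !inE.
  by case/or4P => /eqP e; apply/or4P; [apply: Or41 | apply: Or42 | apply: Or43 | apply: Or44];
    apply/eqP/inj; rewrite e ?imset0 ?val_imsetT.
Qed.

End Restrict.

(** * Faces of a component compared with faces of the whole matroid *)

Section ComponentFaces.
Variables (T : finType) (M : matroid T) (C : {set T}).
Hypothesis hC : separator M C.
Implicit Types (F S : {set T}).
Local Notation r := (rank M).
Local Notation L := (loops M).

Lemma rankUloops F : r (F :|: L) = r F.
Proof.
have := rankU M F L; rewrite rank_loops addn0 => le.
by apply/eqP; rewrite eqn_leq le rankS // subsetUl.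
Qed.

Let rT : r [set: T] = r C + r (~: C).
Proof. by rewrite (separator_rank _ hC) setTI setTD. Qed.

(** The ranks split along [C] and its complement. Submodularity and subadditivity give the opposites
    of the desired inequalities for free, so the single inequality stating that [S] is a separator
    forces all of them to be tight. *)
Lemma separator_face_lift F S : F \subset C -> separator (face_matroid M (F :|: L)) S ->
  [/\ r ((S :&: C) :&: F) + r (F :\: (S :&: C)) <= r F,
      r (F :|: S :&: C) + r (F :|: C :\: (S :&: C)) <= r F + r C
    & separator M (S :\: C)].
Proof.
move=> FC; rewrite separator_face rankUloops => le.
have h1 : r ((S :&: C) :&: F) <= r (S :&: (F :|: L)).
  by apply/rankS/subsetP => x; rewrite !inE => /andP[/andP[-> _] ->].
have h2 : r (F :\: (S :&: C)) <= r ((F :|: L) :\: S).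
  apply/rankS/subsetP => x; rewrite !inE => /andP[+ xF].
  by rewrite xF (subsetP FC) // andbT => ->.
have h3 : r (F :|: S :&: C) + r (S :\: C) <= r (F :|: L :|: S).
  rewrite [leqRHS](separator_rank _ hC); apply: leq_add; apply/rankS/subsetP => x; rewrite !inE.
    by case/orP => [xF|/andP[-> ->]]; rewrite ?orbT // xF (subsetP FC).
  by case/andP => -> ->; rewrite orbT.
have h4 : r (F :|: C :\: (S :&: C)) + r (~: C :\: S) <= r (F :|: L :|: ~: S).
  rewrite [leqRHS](separator_rank _ hC); apply: leq_add; apply/rankS/subsetP => x; rewrite !inE.
    case/orP => [xF|/andP[+ xC]]; first by rewrite xF (subsetP FC).
    by rewrite xC andbT => ->; rewrite orbT.
  by case/andP => -> ->; rewrite orbT.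
have h5 : r F <= r ((S :&: C) :&: F) + r (F :\: (S :&: C)).
  by have := rankU M (F :&: (S :&: C)) (F :\: (S :&: C)); rewrite setID (setIC F).
have h6 : r C + r F <= r (F :|: S :&: C) + r (F :|: C :\: (S :&: C)).
  have := rank_submod M (F :|: S :&: C) (F :|: C :\: (S :&: C)).
  have -> : (F :|: S :&: C) :|: (F :|: C :\: (S :&: C)) = C.
    apply/setP => x; rewrite !inE; have := subsetP FC x.
    by case: (x \in F) => [->|_] //=; case: (x \in S); case: (x \in C).
  have -> // : (F :|: S :&: C) :&: (F :|: C :\: (S :&: C)) = F.
  by apply/setP => x; rewrite !inE; case: (x \in F); case: (x \in S); case: (x \in C).
have h7 : r (~: C) <= r (S :\: C) + r (~: C :\: S).
  apply: leq_trans (rankU _ _ _); apply/rankS/subsetP => x; rewrite !inE.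
  by case: (x \in S) => ->.
have h8 : r (~: (S :\: C)) <= r C + r (~: C :\: S).
  apply: leq_trans (rankU _ _ _); apply/rankS/subsetP => x; rewrite !inE.
  by case: (x \in S); case: (x \in C).
rewrite separatorE; move: le h1 h2 h3 h4 h5 h6 h7 h8 rT; clear => *; split; lia.
Qed.

(** Bounding the four ranks in [separator_face] by their shares in [C] costs [r (F :\: C)] twice and
    [r (~: C)] once, exactly what its right-hand side leaves over. *)
Lemma separator_face_desc F S : S \subset C ->
  r (S :&: (F :&: C)) + r (F :&: C :\: S) <= r (F :&: C) ->
  r (F :&: C :|: S) + r (F :&: C :|: C :\: S) <= r (F :&: C) + r C ->
  separator (face_matroid M F) S.
Proof.
move=> SC le1 le2; rewrite separator_face.
have eF := separator_rank F hC.
have h1 : r (S :&: F) <= r (S :&: (F :&: C)).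
  apply/rankS/subsetP => x; rewrite !inE => /andP[xS xF].
  by rewrite xS xF (subsetP SC).
have h2 : r (F :\: S) <= r (F :&: C :\: S) + r (F :\: C).
  apply: leq_trans (rankU _ _ _); apply/rankS/subsetP => x; rewrite !inE.
  by case: (x \in F); case: (x \in S); case: (x \in C).
have h3 : r (F :|: S) <= r (F :&: C :|: S) + r (F :\: C).
  apply: leq_trans (rankU _ _ _); apply/rankS/subsetP => x; rewrite !inE.
  by case: (x \in F); case: (x \in S); case: (x \in C).
have h4 : r (F :|: ~: S) <= r (F :&: C :|: C :\: S) + r (~: C).
  apply: leq_trans (rankU _ _ _); apply/rankS/subsetP => x; rewrite !inE.
  by case: (x \in F); case: (x \in S); case: (x \in C).
by move: le1 le2 h1 h2 h3 h4 eF rT; clear; lia.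
Qed.

Lemma flat_lift F : F \subset C -> (forall x, x \in C -> x \notin F -> r F < r (x |: F)) ->
  flat M (F :|: L).
Proof.
move=> FC fl; apply/flatP => x; rewrite inE negb_or rankUloops => /andP[xF xL].
have [xC|xC] := boolP (x \in C).
  apply: leq_trans (fl x xC xF) _; apply: rankS; exact/setUS/subsetUl.
rewrite [ltnRHS](separator_rank _ hC) -[ltnLHS]addn0 -addnS; apply: leq_add.
  by apply: rankS; rewrite subsetI FC andbT; apply/subsetP => y; rewrite !inE => ->; rewrite orbT.
have : 0 < r [set x] by rewrite lt0n; move: xL; rewrite inE.
by move/leq_trans; apply; apply: rankS; rewrite sub1set !inE eqxx xC.
Qed.

Lemma flat_trace F x : flat M F -> x \in C -> x \notin F :&: C ->
  r (F :&: C) < r (x |: (F :&: C)).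
Proof.
move=> /flatP fl xC; rewrite inE xC andbT => /fl.
have := rank_submod M (x |: (F :&: C)) F.
have -> : (x |: F :&: C) :|: F = x |: F.
  by rewrite -setUA (setUidPr (subsetIl _ _)).
have : r (F :&: C) <= r ((x |: F :&: C) :&: F).
  by apply: rankS; rewrite subsetI subsetIl andbT subsetUr.
by clear; lia.
Qed.

End ComponentFaces.

Import Order.TTheory GRing.Theory Num.Theory.

(** * Affine and convex hulls *)

Section Affine.
Local Open Scope ring_scope.
Local Open Scope classical_set_scope.
Variables (R : realType) (T : finType).
Local Notation E := {ffun T -> R^o}.
Implicit Types (S Q K : set E) (x y z l u : E) (A B C : {set T}).

(** Valued in [R^o] so that [linfun] and [lker] apply to it. *)
Definition dot l x : R^o := \sum_i l i * x i.

Fact dot_is_linear l : linear (dot l).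
Proof.
move=> a x y; rewrite /dot scaler_sumr -big_split; apply: eq_bigr => i _.
by rewrite !ffunE mulrDr /= /GRing.scale /= mulrCA.
Qed.

HB.instance Definition _ l := GRing.isLinear.Build R E R^o _ (dot l) (dot_is_linear l).

Lemma dot_charvec A x : dot (charvec R A) x = \sum_(i in A) x i.
Proof.
rewrite /dot [RHS]big_mkcond; apply: eq_bigr => i _; rewrite ffunE.
by case: (i \in A); rewrite ?mul1r ?mul0r.
Qed.

Lemma dotDl l l' x : dot (l + l') x = dot l x + dot l' x.
Proof. by rewrite /dot -big_split; apply: eq_bigr => i _; rewrite !ffunE mulrDl. Qed.

Lemma dotZl (a : R) l x : dot (a *: l) x = a * dot l x.
Proof. by rewrite /dot mulr_sumr; apply: eq_bigr => i _; rewrite !ffunE -mulrA. Qed.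

Lemma sum_charvec A B : \sum_(i in A) charvec R B i = #|B :&: A|%:R.
Proof.
rewrite -sum1_card natr_sum big_mkcond [RHS]big_mkcond; apply: eq_bigr => i _.
by rewrite ffunE inE; case: (i \in A); case: (i \in B).
Qed.

Lemma sumD A x y : \sum_(i in A) (x + y) i = \sum_(i in A) x i + \sum_(i in A) y i.
Proof. by rewrite -!dot_charvec linearD. Qed.

Lemma sumB A x y : \sum_(i in A) (x - y) i = \sum_(i in A) x i - \sum_(i in A) y i.
Proof. by rewrite -!dot_charvec linearB. Qed.

Lemma sumZ A (t : R) x : \sum_(i in A) (t *: x) i = t * \sum_(i in A) x i.
Proof. by rewrite -!dot_charvec linearZ. Qed.

Lemma sumID A C x :
  \sum_(i in A) x i = \sum_(i in A :&: C) x i + \sum_(i in A :\: C) x i.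
Proof. exact: big_setID. Qed.

Lemma comb_in (S : set E) (k : nat) (c : 'I_k -> R) (p : 'I_k -> E) l (b : R) :
  (forall i, S (p i)) -> (forall x, S x -> dot l x = b) ->
  dot l (\sum_i c i *: p i) = \sum_i c i * b.
Proof.
move=> hp h; rewrite linear_sum; apply: eq_bigr => i _.
by rewrite linearZ /= h.
Qed.

Lemma aff_eq S l (b : R) : (forall x, S x -> dot l x = b) ->
  forall x, aff S x -> dot l x = b.
Proof.
move=> h x [k [c [p [hp c1 ->]]]]; rewrite (comb_in _ hp h) -mulr_suml.
by rewrite -[X in _ = X]mul1r -c1.
Qed.

Lemma sub_aff S : S `<=` aff S.
Proof.
move=> x Sx; exists 1%N, (fun=> 1), (fun=> x); split=> //.
  by rewrite big_ord1.
by rewrite big_ord1 scale1r.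
Qed.

Lemma sub_conv S : S `<=` conv S.
Proof.
move=> x Sx; exists 1%N, (fun=> 1), (fun=> x); split=> //.
  by rewrite big_ord1.
by rewrite big_ord1 scale1r.
Qed.

Lemma aff_mono S Q : S `<=` Q -> aff S `<=` aff Q.
Proof. by move=> SQ x [k [c [p [hp c1 ->]]]]; exists k, c, p; split=> // i; apply: SQ. Qed.

Lemma conv_mono S Q : S `<=` Q -> conv S `<=` conv Q.
Proof. by move=> SQ x [k [c [p [hp c0 c1 ->]]]]; exists k, c, p; split=> // i; apply: SQ. Qed.

(** The predicate [P] is trivial for affine hulls and nonnegativity for convex hulls, so one
    concatenation of coefficients serves both. *)
Lemma comb_line k1 k2 (c1 : 'I_k1 -> R) (c2 : 'I_k2 -> R) (p1 : 'I_k1 -> E) (p2 : 'I_k2 -> E)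
    (S : set E) (P : pred R) t : 
  (forall i, S (p1 i)) -> (forall i, S (p2 i)) ->
  (forall i, P (t * c1 i)) -> (forall i, P ((1 - t) * c2 i)) ->
  \sum_i c1 i = 1 -> \sum_i c2 i = 1 ->
  exists (c : 'I_(k1 + k2) -> R) (p : 'I_(k1 + k2) -> E),
    [/\ forall i, S (p i), forall i, P (c i), \sum_i c i = 1
      & t *: (\sum_i c1 i *: p1 i) + (1 - t) *: (\sum_i c2 i *: p2 i) = \sum_i c i *: p i].
Proof.
move=> S1 S2 P1 P2 e1 e2.
exists (fun i => match fintype.split i with inl j => t * c1 j | inr j => (1 - t) * c2 j end).
exists (fun i => match fintype.split i with inl j => p1 j | inr j => p2 j end).
have sl j : fintype.split (lshift k2 j) = inl j by exact: (unsplitK (inl j)).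
have sr j : fintype.split (rshift k1 j) = inr j by exact: (unsplitK (inr j)).
split.
- by move=> i; case: fintype.split.
- by move=> i; case: fintype.split.
- rewrite big_split_ord /= (eq_bigr (fun i => t * c1 i)) => [|i _]; last by rewrite sl.
  rewrite [X in _ + X](eq_bigr (fun i => (1 - t) * c2 i)) => [|i _]; last by rewrite sr.
  by rewrite -!mulr_sumr e1 e2; ring.
- rewrite big_split_ord /=; congr (_ + _); rewrite scaler_sumr; apply: eq_bigr => i _.
    by rewrite sl scalerA.
  by rewrite sr scalerA.
Qed.

Lemma aff_line S x y (t : R) : aff S x -> aff S y -> aff S (t *: x + (1 - t) *: y).
Proof.
move=> [k1 [c1 [p1 [h1 e1 ->]]]] [k2 [c2 [p2 [h2 e2 ->]]]].
have [c [p [? _ ? ->]]] := comb_line h1 h2 (P := predT) (t := t) (fun=> isT) (fun=> isT) e1 e2.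
by exists (k1 + k2)%N, c, p.
Qed.

Lemma conv_line S x y (t : R) : 0 <= t <= 1 -> conv S x -> conv S y ->
  conv S (t *: x + (1 - t) *: y).
Proof.
move=> /andP[t0 t1] [k1 [c1 [p1 [h1 g1 e1 ->]]]] [k2 [c2 [p2 [h2 g2 e2 ->]]]].
have [i|i|c [p [? ? ? ->]]] := comb_line h1 h2 (P := fun a => 0 <= a) (t := t) _ _ e1 e2.
- exact: mulr_ge0.
- by rewrite mulr_ge0 // subr_ge0.
by exists (k1 + k2)%N, c, p.
Qed.

Lemma aff_add S x y z (t : R) : aff S x -> aff S y -> aff S z -> aff S (z + t *: (x - y)).
Proof.
move=> hx hy hz.
(* The target is the reflection of [y] in the midpoint of [z] and a point of the line through [x]
   and [y]. *)
have h1 := aff_line 2^-1 hz (aff_line t hx hy).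
suff -> : z + t *: (x - y) =
    2 *: (2^-1 *: z + (1 - 2^-1) *: (t *: x + (1 - t) *: y)) + (1 - 2) *: y.
  exact: aff_line.
by apply/ffunP => i; rewrite !ffunE /GRing.scale /=; field.
Qed.

Lemma conv_ge S l (b : R) : (forall x, S x -> b <= dot l x) ->
  forall x, conv S x -> b <= dot l x.
Proof.
move=> h x [k [c [p [hp c0 c1 ->]]]]; rewrite linear_sum -[leLHS]mul1r -c1 mulr_suml.
by apply: ler_sum => i _; rewrite linearZ /=; apply: ler_wpM2l => //; apply: h.
Qed.

Lemma conv_le S l (b : R) : (forall x, S x -> dot l x <= b) ->
  forall x, conv S x -> dot l x <= b.
Proof.
move=> h x [k [c [p [hp c0 c1 ->]]]]; rewrite linear_sum -[leRHS]mul1r -c1 mulr_suml.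
by apply: ler_sum => i _; rewrite linearZ /=; apply: ler_wpM2l => //; apply: h.
Qed.

(** A point of positive weight below the bound would pull the whole combination below it. *)
Lemma conv_face S l (b : R) : (forall x, S x -> dot l x <= b) ->
  forall x, conv S x -> dot l x = b -> conv (S `&` [set y | dot l y = b]) x.
Proof.
move=> h x [k [c [p [hp c0 c1 ex]]]] e.
have tight i : c i != 0 -> dot l (p i) = b.
  move=> ci; apply/eqP; rewrite eq_le h //= leNgt; apply/negP => lt.
  have : dot l x < b; last by rewrite e ltxx.
  rewrite ex linear_sum -[ltRHS]mul1r -c1 mulr_suml (bigD1 i) //= [ltRHS](bigD1 i) //=.
  apply: ltr_leD; last by apply: ler_sum => j _; rewrite linearZ /= ler_wpM2l // h.
  by rewrite linearZ /= ltr_pM2l // lt_def ci c0.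
have [i0 ci0] : exists i0, c i0 != 0.
  apply/existsP; apply: contraT; rewrite negb_exists => /forallP h0.
  move: c1; rewrite big1 => [/eqP|i _]; first by rewrite eq_sym oner_eq0.
  by apply/eqP; have := h0 i; rewrite negbK.
(* Points of weight 0 may lie off the face and are replaced by one of nonzero weight. *)
exists k, c, (fun i => if c i == 0 then p i0 else p i); split=> //.
- by move=> i; case: eqVneq => [_|ci]; split; rewrite //= tight.
- rewrite ex; apply: eq_bigr => i _; case: eqVneq => [->|//]; by rewrite !scale0r.
Qed.

Lemma has_dim_aff S p (U : {vspace E}) : S p ->
  (forall x, aff S x <-> x - p \in U) -> has_dim S (\dim U).
Proof.
move=> Sp h; exists p, U; split=> //; apply/seteqP; split => x.
  by move/h => hx; exists (x - p) => //; rewrite addrC subrK.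
by move=> [u hu <-]; apply/h; rewrite addrC addKr.
Qed.

Lemma has_dim_uniq S k k' : has_dim S k -> has_dim S k' -> k = k'.
Proof.
move=> [p [U [Sp eU <-]]] [p' [U' [Sp' eU' <-]]].
have sub (q q' : E) (V V' : {vspace E}) : aff S = [set q + u | u in [set u | u \in V]] ->
    aff S = [set q' + u | u in [set u | u \in V']] -> (V <= V')%VS.
  move=> e e'; apply/subvP => v hv.
  have : aff S (q + v) by rewrite e; exists v.
  have : aff S q by rewrite e; exists 0; rewrite ?addr0 //= mem0v.
  rewrite e' => -[a ha ea] [b hb eb]; suff -> : v = b - a by apply: memvB.
  by apply: (addrI q); rewrite -eb -ea -addrA [a + _]addrC subrK.
by congr (\dim _); apply/eqP; rewrite eqEsubv (sub p p') // (sub p' p).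
Qed.

Lemma dim_capv_lker (U : {vspace E}) l u : u \in U -> dot l u != 0 ->
  \dim U = (\dim (U :&: lker (linfun (dot l))))%VS.+1.
Proof.
move=> hu nz; have := limg_ker_dim (linfun (dot l)) U => <-.
suff -> : \dim (linfun (dot l) @: U)%VS = 1%N by rewrite addn1.
apply/eqP; rewrite eqn_leq; apply/andP; split.
  by have := dimvS (subvf (linfun (dot l) @: U)%VS); rewrite dimvf.
rewrite lt0n dimv_eq0; apply: contra nz => /eqP e.
have : linfun (dot l) u \in (linfun (dot l) @: U)%VS by apply: memv_img.
by rewrite e memv0 lfunE.
Qed.

End Affine.

(** * The affine hull of the matroid polytope *)

Section MatroidPolytope.
Local Open Scope ring_scope.
Local Open Scope classical_set_scope.
Variables (R : realType) (T : finType) (N : matroid T).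
Local Notation E := {ffun T -> R^o}.
Implicit Types (x y z u : E) (A B C S Z : {set T}).
Local Notation P := (@matroid_polytope R T N).
Local Notation e i := (charvec R [set i]%SET).

Lemma charvec_polytope B : basis N B -> P (charvec R B).
Proof. by move=> hB; apply: sub_conv; exists B. Qed.

Lemma polytope_le S x : P x -> \sum_(i in S) x i <= (rank N S)%:R.
Proof.
rewrite -dot_charvec; apply: conv_le => _ [B hB <-].
rewrite dot_charvec sum_charvec ler_nat; apply: leq_rank; first exact: subsetIr.
by move: hB; rewrite /= basisE => /andP[+ _]; apply: indepS; exact: subsetIl.
Qed.

Lemma basis_separator B S : basis N B -> separator N S -> #|B :&: S| = rank N S.
Proof.
rewrite basisE => /andP[iB /eqP cB] hS.
have h0 := separator_rank [set: T] hS; rewrite setTI setTD in h0.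
have h1 : (#|B :&: S| <= rank N S)%N.
  by apply: leq_rank; [exact: subsetIr | apply: indepS iB; exact: subsetIl].
have h2 : (#|B :\: S| <= rank N (~: S))%N.
  apply: leq_rank; last by apply: indepS iB; exact: subsetDl.
  by rewrite setDE; exact: subsetIr.
have := cardsID S B; move: cB h0 h1 h2; clear; lia.
Qed.

Lemma aff_separator S x : separator N S -> aff P x -> \sum_(i in S) x i = (rank N S)%:R.
Proof.
move=> hS; rewrite -dot_charvec; apply: aff_eq => y Py; apply/eqP; rewrite eq_le; apply/andP.
split; first by rewrite dot_charvec polytope_le.
move: y Py; apply: conv_ge => _ [B hB <-].
by rewrite dot_charvec sum_charvec (basis_separator hB hS).
Qed.

Definition direction u := forall z, aff P z -> forall t : R, aff P (z + t *: u).

Lemma direction0 : direction 0.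
Proof. by move=> z hz t; rewrite scaler0 addr0. Qed.

Lemma directionD u v : direction u -> direction v -> direction (u + v).
Proof. by move=> hu hv z hz t; rewrite scalerDr addrA; apply/hv/hu. Qed.

Lemma directionZ (a : R) u : direction u -> direction (a *: u).
Proof. by move=> hu z hz t; rewrite scalerA; apply: hu. Qed.

Lemma directionB x y : aff P x -> aff P y -> direction (x - y).
Proof. by move=> hx hy z hz t; apply: aff_add. Qed.

(** Basis exchanges produce related pairs. The classes of this equivalence turn out to be
    separators, so the equations of the separators already cut out the affine hull. *)
Let near i j := direction (e i - e j).

Let near_refl i : near i i.
Proof. by rewrite /near subrr; apply: direction0. Qed.

Let near_sym i j : near i j -> near j i.
Proof. by move=> h; rewrite /near -opprB -scaleN1r; apply: directionZ. Qed.

Let near_trans i j k : near i j -> near j k -> near i k.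
Proof.
move=> h h'; have := directionD h h'.
by rewrite /near addrA subrK.
Qed.

(* Otherwise a basis exchange would relate an element of Z to one outside of Z. *)
Let rank_near B Z : basis N B -> (forall i j, i \in Z -> near i j -> j \in Z) ->
  (rank N Z <= #|B :&: Z|)%N.
Proof.
move=> hB hZ; rewrite leqNgt; apply/negP => /(exchange_basis hB).
move=> [x [y [/setDP[xB xZ] /setDP[yZ yB] hB']]].
case/negP: xZ; apply: hZ yZ _; rewrite /near.
have -> : e y - e x = charvec R (y |: B :\ x) - charvec R B.
  apply/ffunP => i; rewrite !ffunE !inE.
  have [->|ix] := eqVneq i x.
    rewrite xB; have [exy|] := eqVneq x y; first by rewrite -exy xB in yB.
    by [].
  have [->|iy] /= := eqVneq i y; first by rewrite (negPf yB).
  by rewrite subrr [RHS]subrr.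
by apply: directionB; apply: sub_aff; exact: charvec_polytope.
Qed.

(** By [rank_near], one basis meets the class and its complement in at least their ranks, which
    therefore add up to at most its size. *)
Let class_separator i : separator N [set j | `[< near i j >]]%SET.
Proof.
rewrite separatorE; have [B hB] := basis_witness N.
set Y := finset _.
have h1 : (rank N Y <= #|B :&: Y|)%N.
  apply: rank_near => // j k; rewrite !inE => /asboolP h /(near_trans h) h'.
  exact/asboolP.
have h2 : (rank N (~: Y) <= #|B :&: ~: Y|)%N.
  apply: rank_near => // j k; rewrite !inE => /asboolP h /near_sym h'.
  by apply/asboolP => /near_trans /(_ h').
move: (hB); rewrite basisE => /andP[_ /eqP <-].
by have := cardsID Y B; rewrite setDE; move: h1 h2; clear; lia.
Qed.

(** Since [u] sums to zero over each class, it is a combination of the vectors [e j - e (rep j)],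
    with [rep j] a fixed representative of the class of [j]. *)
Lemma direction_separators u :
  (forall S, separator N S -> \sum_(i in S) u i = 0) -> direction u.
Proof.
move=> hu; pose rep j := odflt j [pick k | `[< near j k >]].
have repP j : near j (rep j).
  by rewrite /rep; case: pickP => [k /asboolP //|]; move/(_ j)/asboolP; case; exact: near_refl.
have repE j k : near j k -> rep j = rep k.
  move=> h; rewrite /rep (@eq_pick _ _ (fun l => `[< near k l >])) => [|l].
    by case: pickP => //; move/(_ k)/asboolP; case; exact: near_refl.
  by apply/asboolP/asboolP; apply: near_trans => //; exact: near_sym.
have -> : u = \sum_j u j *: (e j - e (rep j)).
  apply/ffunP => k; rewrite sum_ffunE.
  under eq_bigr do rewrite !ffunE scalerBr !inE.
  rewrite big_split /= sumrN.
  have -> : \sum_j u j *: ((k == j)%:R : R^o) = u k.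
    rewrite (bigD1 k) //= eqxx big1 ?addr0 => [|j jk].
      by rewrite /GRing.scale /= mulr1.
    by rewrite eq_sym (negPf jk) scaler0.
  suff -> : \sum_j u j *: ((k == rep j)%:R : R^o) = 0 by rewrite subr0.
  (* At a representative the subtracted sum is that of [u] over its class; at any other coordinate
     all its terms vanish. *)
  have [ek|nk] := eqVneq k (rep k).
    rewrite -[RHS](hu _ (class_separator k)) [RHS]big_mkcond /=; apply: eq_bigr => j _.
    rewrite inE; case: asboolP => [/repE h|h].
      by rewrite -h -ek eqxx /GRing.scale /= mulr1.
    have [ekj|_] := eqVneq k (rep j); last by rewrite scaler0.
    by case: h; rewrite ekj; apply: near_sym.
  rewrite big1 // => j _; have [ekj|_] := eqVneq k (rep j); last by rewrite scaler0.
  by case/eqP: nk; rewrite {1}ekj; apply: repE; rewrite ekj.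
apply: big_ind => [||j _]; first exact: direction0.
  by move=> ? ?; exact: directionD.
exact/directionZ/repP.
Qed.

Lemma aff_polytope x :
  aff P x <-> (forall S, separator N S -> \sum_(i in S) x i = (rank N S)%:R).
Proof.
split=> [hx S hS|hx]; first exact: aff_separator.
have [B hB] := basis_witness N; have PB := sub_aff (charvec_polytope hB).
have -> : x = charvec R B + (1 : R) *: (x - charvec R B).
  by rewrite scale1r addrC subrK.
apply: (direction_separators _ PB) => S hS.
by rewrite sumB hx // (aff_separator hS PB) subrr.
Qed.

Definition dirspace : {vspace E} :=
  (\bigcap_(S : {set T} | separator N S) lker (linfun (dot (charvec R S))))%VS.

Lemma dirspaceP u :
  u \in dirspace <-> (forall S, separator N S -> \sum_(i in S) u i = 0).
Proof.
split=> [hu S hS|hu].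
  have : (dirspace <= lker (linfun (dot (charvec R S))))%VS by exact: bigcapv_inf hS _.
  by move/subvP/(_ u hu); rewrite memv_ker lfunE /= dot_charvec => /eqP.
have : (<[u]> <= dirspace)%VS.
  apply/subv_bigcapP => S hS; rewrite -memvE memv_ker lfunE /= dot_charvec.
  by rewrite hu.
by rewrite -memvE.
Qed.

Lemma aff_dirspace p x : aff P p -> aff P x <-> x - p \in dirspace.
Proof.
move=> hp; split=> [hx|hx].
  by apply/dirspaceP => S hS; rewrite sumB !(aff_separator hS) // subrr.
apply/aff_polytope => S hS; have /dirspaceP/(_ S hS) := hx.
by rewrite sumB (aff_separator hS hp) => /eqP; rewrite subr_eq0 => /eqP.
Qed.

Lemma has_dim_polytope : has_dim P (\dim dirspace).
Proof.
have [B hB] := basis_witness N; have PB := charvec_polytope hB.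
by apply: (has_dim_aff PB) => x; exact: (aff_dirspace _ (sub_aff PB)).
Qed.

Lemma dirspace_swap C i j : component N C -> i \in C -> j \in C -> e i - e j \in dirspace.
Proof.
move=> hC iC jC; apply/dirspaceP => S hS.
have h k : k \in C -> (k \in S) = (C \subset S).
  move=> kC; have [CS|] := component_separator hC hS; first by rewrite CS (subsetP CS).
  move=> dis; rewrite (disjointFr dis kC); apply/esym/negP => /subsetP/(_ k kC).
  by rewrite (disjointFr dis kC).
rewrite sumB !sum_charvec; have c k : #|[set k] :&: S| = (k \in S).
  have [kS|kS] := boolP (k \in S).
    by rewrite (setIidPl _) ?cards1 // sub1set.
  by rewrite disjoint_setI0 ?cards0 // disjoints1.
by rewrite !c !h // subrr.
Qed.

End MatroidPolytope.

(** * Flacets *)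

Section Flacets.
Local Open Scope ring_scope.
Local Open Scope classical_set_scope.
Variables (R : realType) (T : finType) (M : matroid T).
Local Notation E := {ffun T -> R^o}.
Implicit Types (x y z u v : E) (A B C F G S Z : {set T}).
Local Notation P := (@matroid_polytope R T M).
Local Notation e i := (charvec R [set i]%SET).
Local Notation L := (loops M).
Local Notation r := (rank M).
Local Notation face F := (@flat_face R T M F).
Local Notation dirspace N := (@dirspace R T N).

Lemma sum_unit S i : \sum_(j in S) e i j = (i \in S)%:R.
Proof.
rewrite sum_charvec; have [iS|iS] := boolP (i \in S).
  by rewrite (setIidPl _) ?cards1 // sub1set.
by rewrite disjoint_setI0 ?cards0 // disjoints1.
Qed.

(** The sum over [F] is at most [r F] on P(M), so [conv_face] retains just the bases attaining it.
    Conversely [F] separates the face matroid, which fixes that sum. *)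
Lemma flat_faceE F : face F = @matroid_polytope R T (face_matroid M F).
Proof.
apply/seteqP; split => x.
  move=> [Px ex]; have h (y : E) : [set charvec R B | B in [set B | basis M B]] y ->
      dot (charvec R F) y <= (r F)%:R.
    by move=> [B hB <-]; rewrite dot_charvec; apply: polytope_le; exact: charvec_polytope.
  have := conv_face h Px; rewrite dot_charvec => /(_ ex); apply: conv_mono.
  move=> _ [[B hB <-]] /=; rewrite dot_charvec sum_charvec => /eqP; rewrite eqr_nat => hF.
  by exists B => //=; rewrite basis_face hF andbT.
move=> hx; split.
  move: hx; apply: conv_mono => y [B /=]; rewrite basis_face => /andP[hB _] <-.
  by exists B.
have hF : separator (face_matroid M F) F.
  by rewrite separator_face setIid setDv rank0 setUid setUCr; lia.
rewrite /= (aff_separator hF (sub_aff hx)); congr (_%:R).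
have := rank_face M F F; rewrite setIid setUid.
by clear; lia.
Qed.

Lemma face_basis F : exists2 B, basis M B & face F (charvec R B).
Proof.
have [B hB] := basis_witness (face_matroid M F).
exists B; last by rewrite flat_faceE; exact: charvec_polytope.
by move: hB; rewrite basis_face => /andP[].
Qed.

Lemma dirspace_faceS F u : u \in dirspace (face_matroid M F) ->
  u \in dirspace M /\ \sum_(i in F) u i = 0.
Proof.
move=> hu; have [B hB fB] := face_basis F; split.
  have PB : aff P (charvec R B) by apply: sub_aff; case: fB.
  have -> : u = (charvec R B + u) - charvec R B by rewrite addrAC subrr add0r.
  rewrite -(aff_dirspace _ PB); have : aff (face F) `<=` aff P by apply: aff_mono => x [].
  have aB := sub_aff fB; rewrite flat_faceE in aB *.
  by apply; apply/(aff_dirspace _ aB); rewrite addrAC subrr add0r.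
have /dirspaceP := hu; apply.
by rewrite separator_face setIid setDv rank0 setUid setUCr; lia.
Qed.

Lemma has_dim_face F : has_dim (face F) (\dim (dirspace (face_matroid M F))).
Proof. by rewrite flat_faceE; exact: has_dim_polytope. Qed.

Lemma facet_proper F : facet P (face F) -> face F <> P.
Proof. by move=> [_ [k h1 h2]] e0; rewrite e0 in h1; have := has_dim_uniq h1 h2; lia. Qed.

Lemma face_const F : (forall u, u \in dirspace M -> \sum_(i in F) u i = 0) -> face F = P.
Proof.
move=> h; apply/seteqP; split=> x; first by case.
move=> Px; split=> //=; have [B hB [PB eB]] := face_basis F.
have : x - charvec R B \in dirspace M.
  by rewrite -(aff_dirspace _ (sub_aff PB)); apply: sub_aff.
by move/h; rewrite sumB => /eqP; rewrite subr_eq0 => /eqP ->.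
Qed.

(** The directions of the face lie in the kernel of the sum over [F] on [dirspace M]. Being a facet
    means that this kernel is a hyperplane of [dirspace M] and that the face fills it. *)
Lemma facetP F : facet P (face F) <->
  (exists2 u, u \in dirspace M & \sum_(i in F) u i != 0) /\
  (forall u, u \in dirspace M -> \sum_(i in F) u i = 0 -> u \in dirspace (face_matroid M F)).
Proof.
pose K := (dirspace M :&: lker (linfun (dot (charvec R F))))%VS.
have KP u : u \in K = (u \in dirspace M) && (\sum_(i in F) u i == 0).
  by rewrite memv_cap memv_ker lfunE /= dot_charvec.
have sub : (dirspace (face_matroid M F) <= K)%VS.
  apply/subvP => u /dirspace_faceS[hu e0].
  by rewrite KP hu e0 eqxx.
split=> [hF|[[u hu nz] h]].
  have [u hu nz] : exists2 u, u \in dirspace M & \sum_(i in F) u i != 0.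
    apply/not_exists2P => h; apply: (facet_proper hF); apply: face_const => u hu.
    by case: (h u) => [//|/negP]; rewrite negbK => /eqP.
  split; first by exists u.
  case: hF => _ [k h1 h2]; have e1 := has_dim_uniq h1 (has_dim_face F).
  have e2 := has_dim_uniq h2 (@has_dim_polytope R T M).
  have nz' : dot (charvec R F) u != 0 by rewrite dot_charvec.
  have := dim_capv_lker hu nz'; rewrite -e2 => -[e3].
  have /eqP -> : dirspace (face_matroid M F) == K by rewrite eqEdim sub -e1 e3 leqnn.
  by move=> v hv hv0; rewrite KP hv hv0 eqxx.
split.
  exists (charvec R F), (r F)%:R; split.
    by move=> x Px; have := polytope_le F Px; rewrite -dot_charvec.
  by apply/seteqP; split=> x [Px ex]; split=> //; move: ex; rewrite /= -dot_charvec.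
exists (\dim (dirspace (face_matroid M F))); first exact: has_dim_face.
have nz' : dot (charvec R F) u != 0 by rewrite dot_charvec.
have -> : dirspace (face_matroid M F) = K.
  apply/eqP; rewrite eqEsubv sub; apply/subvP => v; rewrite KP => /andP[hv /eqP].
  exact: h.
by rewrite /K -(dim_capv_lker hu nz'); exact: has_dim_polytope.
Qed.

Lemma separator_loops : separator M L.
Proof. by rewrite separatorE rank_loops add0n; apply: rankS; exact: subsetT. Qed.

Lemma dirspace_loops u : u \in dirspace M -> \sum_(i in L) u i = 0.
Proof. by move/dirspaceP; apply; exact: separator_loops. Qed.

Lemma sumUloops F x : [disjoint F & L]%B ->
  \sum_(i in F :|: L) x i = \sum_(i in F) x i + \sum_(i in L) x i.
Proof.
move=> dis; rewrite (sumID _ L) addrC setIUl setIid disjoint_setI0 // set0U.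
by rewrite setDUl setDv setU0 (setDidPl _).
Qed.

(** A separator of the face matroid meets [C] in one of the four sets allowed by [facial] and is a
    separator of [M] off [C]. A direction of P(M) with zero sum over [F] has zero sum over all of
    these. *)
Lemma flacet_lift C F : component M C -> (1 < #|C|)%N -> facial M C F ->
  flacet R M (F :|: L).
Proof.
move=> hC C1 [FC F0 FnC fl pr]; have /componentP[_ sC _] := hC.
have CL := component_loops hC C1.
have FL : [disjoint F & L]%B by exact: disjointWl FC CL.
have sumF u : u \in dirspace M -> \sum_(i in F :|: L) u i = \sum_(i in F) u i.
  by move=> hu; rewrite sumUloops // dirspace_loops // addr0.
have inF i : i \in C -> (i \in F :|: L) = (i \in F).
  by move=> iC; rewrite inE (disjointFr CL iC) orbF.
have hf : facet P (face (F :|: L)).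
  apply/facetP; split.
    have [i iF] : exists i, i \in F by apply/set0Pn.
    have [j jC jF] : exists2 j, j \in C & j \notin F.
      by apply/subsetPn; apply: contra FnC => CF; rewrite eqEsubset FC.
    exists (e i - e j); first exact: dirspace_swap hC (subsetP FC i iF) jC.
    rewrite sumB !sum_unit !inF ?(subsetP FC i iF) // iF (negPf jF) subr0.
    exact: oner_neq0.
  move=> u hu; rewrite sumF // => uF; apply/dirspaceP => S hS.
  have [h1 h2 h3] := separator_face_lift sC FC hS.
  have /dirspaceP hu' := hu; rewrite (sumID S C) (hu' _ h3) addr0.
  have uC := hu' _ sC.
  have := pr _ (subsetIr S C) h1 h2; rewrite !inE => /or4P[] /eqP ->.
  - by rewrite big_set0.
  - by [].
  - by move: uC; rewrite (sumID C F) (setIidPr FC) uF add0r.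
  - by [].
split=> //; first exact: (flat_lift sC FC fl).
move=> G fG fcG eG GF; have LG := flat_loops fG.
apply/eqP; rewrite eqEsubset GF; apply/subsetP => i iFL; apply: contraT => iG.
have iF : i \in F.
  by move: iFL; rewrite inE => /orP[//|/(subsetP LG)]; rewrite (negPf iG).
(* Minimality: if [G] omits [i] but keeps some [j] of [F], moving along [e i - e j] stays in the
   affine hull of the face and changes the sum over [G]. If it keeps none, [G] is the set of loops,
   whose face is all of P(M). *)
have [[j]|] := pselect (exists j, j \in G :&: F).
  move=> /setIP[jG jF]; have [B hB fB] := face_basis (F :|: L).
  have [iC jC] := (subsetP FC i iF, subsetP FC j jF).
  have hu := @dirspace_swap R T M C i j hC iC jC.
  have h : aff (face (F :|: L)) (charvec R B + (e i - e j)).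
    have aB := sub_aff fB; rewrite flat_faceE in aB *.
    apply/(aff_dirspace _ aB); rewrite addrAC subrr add0r; have /facetP[_] := hf; apply => //.
    by rewrite sumF // sumB !sum_unit iF jF subrr.
  have eqG (x : E) : aff (face G) x -> \sum_(i in G) x i = (r G)%:R.
    by rewrite -dot_charvec; apply: aff_eq => y [_]; rewrite /= -dot_charvec.
  have := eqG _ (sub_aff (_ : face G (charvec R B))); rewrite eG => /(_ fB) e1.
  have := eqG (charvec R B + (e i - e j)); rewrite eG => /(_ h).
  rewrite sumD e1 sumB !sum_unit jG (negPf iG) sub0r => /eqP.
  by rewrite -[X in _ == X]addr0 (inj_eq (addrI _)) oppr_eq0 oner_eq0.
move=> nj; case: (facet_proper fcG); apply: face_const => u hu.
suff -> : G = L by exact: dirspace_loops.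
apply/eqP; rewrite eqEsubset LG andbT; apply/subsetP => j jG.
have := subsetP GF j jG; rewrite inE => /orP[jF|//].
by case: nj; exists j; rewrite inE jG.
Qed.

Lemma flacet_desc F : flacet R M F -> exists C,
  [/\ component M C, (1 < #|C|)%N, facial M C (F :&: C) & F = (F :&: C) :|: L].
Proof.
move=> [fF hF minF]; have /facetP[[u0 hu0 nz0] h] := hF.
(* A minimal separator on which the sum over [F] varies is a component: a variation on a union of
   two separators is already visible on one of them. *)
pose good S := separator M S && `[< exists2 u, u \in dirspace M & \sum_(i in F :&: S) u i != 0 >].
have good0 : good [set: T]%SET.
  by rewrite /good separatorT; apply/asboolP; exists u0; rewrite ?setIT.
have [C /minsetP[/andP[sC /asboolP[u hu nz]] minC] _] := minset_exists good0.
have FC0 : F :&: C != set0 by apply: contra nz => /eqP ->; rewrite big_set0.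
have uC : \sum_(i in C) u i = 0 by have /dirspaceP := hu; apply.
have FCC : F :&: C != C by apply: contra nz => /eqP ->; rewrite uC.
have hC : component M C.
  apply/componentP; split=> // [|S hS SC].
    by apply: contra FC0 => /eqP ->; rewrite setI0.
  have [nzS|] := boolP (\sum_(i in F :&: S) u i != 0).
    by right; apply: minC => //; rewrite /good hS; apply/asboolP; exists u.
  rewrite negbK => /eqP zS; left.
  have e1 : \sum_(i in F :&: (C :\: S)) u i != 0.
    apply: contra nz => /eqP e1; rewrite (sumID _ S) -setIA (setIidPr SC) zS add0r.
    by rewrite -setIDA e1.
  have /minC /(_ (subsetDl _ _)) eD : good (C :\: S).
    by rewrite /good separatorD //; apply/asboolP; exists u.
  by apply/eqP; rewrite -(setIidPr SC) -eD setIDAC setDIl setDv setI0.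
have C1 : (1 < #|C|)%N.
  have := proper_card (_ : F :&: C \proper C); rewrite properEneq FCC subsetIr => /(_ isT).
  by apply: leq_trans; rewrite ltnS card_gt0.
have CL := component_loops hC C1.
pose cut S v : E := [ffun i => if i \in S then v i else 0].
have cutE S A v : \sum_(i in A) cut S v i = \sum_(i in A :&: S) v i.
  rewrite (sumID A S) [X in _ + X]big1 ?addr0 => [|i].
    by apply: eq_bigr => i; rewrite inE ffunE => /andP[_ ->].
  by rewrite inE ffunE => /andP[/negPf ->].
have cutP S v : separator M S -> v \in dirspace M -> cut S v \in dirspace M.
  move=> hS /dirspaceP hv; apply/dirspaceP => S' hS'.
  by rewrite cutE; apply/hv/separatorI.
(* A direction [v] varying on [F :\: C] could be balanced against [u] on [C]. The result would be a
   direction of the face that varies on [F :&: C], although this set separates the face matroid. *)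
have zero v : v \in dirspace M -> \sum_(i in F :\: C) v i = 0.
  move=> hv; set b := \sum_(i in F :\: C) v i; set a := \sum_(i in F :&: C) u i in nz.
  have sC' : separator M (~: C) by rewrite -separatorC.
  pose z := a *: cut (~: C) v - b *: cut C u.
  have zF : \sum_(i in F) z i = 0.
    by rewrite sumB !sumZ !cutE -setDE -/a -/b mulrC subrr.
  have zM : z \in dirspace M by apply: memvB; apply: memvZ; exact: cutP.
  have /dirspaceP/(_ (F :&: C)) := h z zM zF.
  have -> : separator (face_matroid M F) (F :&: C).
    apply: (separator_face_desc sC); first exact: subsetIr.
      by rewrite setIid setDv rank0 addn0.
    have -> : F :&: C :|: C :\: (F :&: C) = C.
      by apply/setP => i; rewrite !inE; case: (i \in F); case: (i \in C).
    by rewrite setUid.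
  move=> /(_ isT); rewrite sumB !sumZ !cutE -!setIA setIid setICr.
  rewrite setI0 big_set0 mulr0 sub0r -/a => /eqP; rewrite oppr_eq0 mulf_eq0 (negPf nz) orbF.
  by move/eqP.
have FCL : [disjoint F :&: C & L]%B by apply: disjointWl CL; exact: subsetIr.
have LF := flat_loops fF.
have fl (x : T) : x \in C -> x \notin F :&: C -> (r (F :&: C) < r (x |: (F :&: C)))%N.
  exact: flat_trace.
have fF' : flat M (F :&: C :|: L) by exact: (flat_lift sC (subsetIr F C) fl).
(* The part of [F] outside [C] thus contributes a constant, and dropping it leaves the face
   unchanged; minimality of the flacet then removes everything there except loops. *)
have const x : P x -> \sum_(i in F :\: C) x i = (r (F :\: C))%:R.
  move=> Px; have [I [IF hI cI]] := rank_witness M (F :\: C).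
  have [B hB IB] := basis_extend hI; have PB := @charvec_polytope R T M B hB.
  have e1 : \sum_(i in F :\: C) charvec R B i = (r (F :\: C))%:R.
    apply/eqP; rewrite eq_le polytope_le // sum_charvec ler_nat -cI.
    by apply: subset_leq_card; rewrite subsetI IB.
  have : x - charvec R B \in dirspace M by rewrite -(aff_dirspace _ (sub_aff PB)); apply: sub_aff.
  by move/zero; rewrite sumB e1 => /eqP; rewrite subr_eq0 => /eqP.
have eF : face (F :&: C :|: L) = face F.
  have e1 x : P x -> \sum_(i in F) x i = \sum_(i in F :&: C :|: L) x i + (r (F :\: C))%:R.
    move=> Px; rewrite sumUloops // (aff_separator separator_loops (sub_aff Px)) rank_loops addr0.
    by rewrite -(const _ Px) -sumID.
  have e2 : ((r F)%:R = (r (F :&: C :|: L))%:R + (r (F :\: C))%:R :> R).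
    by rewrite rankUloops -natrD -separator_rank.
  apply/seteqP; split=> x [Px] /= ex; split=> //=.
    by rewrite e1 // ex e2.
  by apply: (addIr (r (F :\: C))%:R); rewrite -e1 // ex e2.
have sub : F :&: C :|: L \subset F by rewrite subUset subsetIl.
have eFF : F :&: C :|: L = F by apply: minF; rewrite ?eF.
exists C; split=> //; split=> //; first exact: subsetIr.
move=> S SC le1 le2; have hS := separator_face_desc sC SC le1 le2.
(* Elements of [C] on the same side of [F] can be traded within the face, so [S] cannot separate
   them. One element from each side then determines [S], whence the four cases. *)
have same i j : i \in C -> j \in C -> (i \in F) = (j \in F) -> (i \in S) = (j \in S).
  move=> iC jC eij; have hij := @dirspace_swap R T M C i j hC iC jC.
  have /dirspaceP/(_ S hS) : e i - e j \in dirspace (face_matroid M F).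
    by apply: h => //; rewrite sumB !sum_unit eij subrr.
  rewrite sumB !sum_unit => /eqP; rewrite subr_eq0 eqr_nat.
  by case: (i \in S); case: (j \in S).
have [i0 /setIP[iF iC]] : exists i, i \in F :&: C by apply/set0Pn.
have [j0 jC jF] : exists2 j, j \in C & j \notin F :&: C.
  by apply/subsetPn; apply: contra FCC => CF; rewrite eqEsubset CF subsetIr.
rewrite inE jC andbT in jF.
have SE (x : T) : (x \in S) = (x \in C) && (if x \in F then i0 \in S else j0 \in S).
  have [xC|xC] /= := boolP (x \in C); last by apply/negP => /(subsetP SC); rewrite (negPf xC).
  by case: ifPn => xF; apply: same => //; rewrite ?iF ?xF // (negPf jF) (negPf xF).
rewrite !inE; apply/or4P; move: SE.
case: (i0 \in S); case: (j0 \in S) => SE; [apply: Or44|apply: Or42|apply: Or43|apply: Or41];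
  by apply/eqP/setP => x; rewrite SE ?inE; case: (x \in F); case: (x \in C).
Qed.

End Flacets.

(** * Splits of the hypersimplex *)

Section Integrality.
Local Open Scope ring_scope.
Local Open Scope classical_set_scope.
Variables (R : realType) (T : finType).
Local Notation E := {ffun T -> R^o}.
Implicit Types (x y z p : E) (i j k : T) (F : {set T}) (d s : nat).
Local Notation e i := (charvec R [set i]%SET).

Local Notation vertices := (range (@charvec R T)).

Definition half_hypersimplex d F s : set E :=
  @hypersimplex R T d `&` [set x : E | \sum_(i in F) x i <= s%:R].

Definition frac x : {set T} := [set i | 0 < x i < 1]%SET.

Lemma frac0 d x : hypersimplex d x -> frac x = set0 -> exists B, x = charvec R B.
Proof.
move=> [cx _] fx; exists [set i | x i == 1]%SET; apply/ffunP => i; rewrite ffunE inE.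
have [-> //|x1] := eqVneq (x i) 1; have /andP[x0 x1'] := cx i.
have [->//|x0'] := eqVneq (x i) 0.
by have := in_set0 i; rewrite -fx inE !lt_neqAle x0 x1' x1 eq_sym x0'.
Qed.

(** A single fractional coordinate would put [d] strictly between the consecutive integers [m] and
    [m + 1]. *)
Lemma frac_second d x i : hypersimplex d x -> i \in frac x ->
  exists2 j, j != i & j \in frac x.
Proof.
move=> [cx sx] fi; apply/not_exists2P => h.
have e0 j : j != i -> x j = (x j == 1)%:R.
  move=> ji; have /andP[x0 x1] := cx j; have [-> //|x1'] := eqVneq (x j) 1.
  apply/eqP; apply: contraT => x0'; case: (h j) => [//|[]].
  by rewrite inE !lt_neqAle x0 x1 x1' eq_sym x0'.
have : x i + (\sum_(j | j != i) (x j == 1%R : nat))%N%:R = d%:R.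
  by rewrite -sx [RHS](bigD1 i) //= natr_sum; congr (_ + _); apply: eq_bigr => j /e0.
move: fi; rewrite inE => /andP[x0 x1]; set m := (\sum_(_ | _) _)%N => em.
have : (m < d)%N by rewrite -(ltr_nat R) -em ltrDr.
have : (d < m.+1)%N by rewrite -(ltr_nat R) -em mulrS ltrD2r.
by lia.
Qed.

Lemma sum_swap F x (t : R) i j :
  \sum_(k in F) (x + t *: (e i - e j)) k = \sum_(k in F) x k + t * ((i \in F)%:R - (j \in F)%:R).
Proof.
have c k : #|[set k]%SET :&: F| = (k \in F).
  have [kS|kS] := boolP (k \in F).
    by rewrite (setIidPl _) ?cards1 // sub1set.
  by rewrite disjoint_setI0 ?cards0 // disjoints1.
by rewrite sumD sumZ sumB !sum_charvec !c.
Qed.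

Lemma sum_setT x : \sum_i x i = \sum_(i in [set: T]%SET) x i.
Proof. by apply: eq_bigl => i; rewrite inE. Qed.

Lemma push d x i j : hypersimplex d x -> i != j -> i \in frac x -> j \in frac x ->
  exists t : R, [/\ 0 < t, t < 1, hypersimplex d (x + t *: (e i - e j))
    & (#|frac (x + t *: (e i - e j))%R| < #|frac x|)%N].
Proof.
move=> [cx sx] ij; rewrite !inE => /andP[xi0 xi1] /andP[xj0 xj1].
(* The largest step within the cube: it takes [x i] to 1 or [x j] to 0, so that a fractional
   coordinate disappears. *)
pose t : R := Num.min (1 - x i) (x j).
have t0 : 0 < t by rewrite lt_min subr_gt0 xi1.
have ti : t <= 1 - x i by rewrite ge_min lexx.
have tj : t <= x j by rewrite ge_min lexx orbT.
have tE : t = 1 - x i \/ t = x j by rewrite /t; case: leP; [left|right].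
pose y : E := x + t *: (e i - e j).
have yE k : y k = x k + t * ((k == i)%:R - (k == j)%:R).
  by rewrite /y !ffunE !inE.
have yi : y i = x i + t by rewrite yE eqxx (negPf ij) subr0 mulr1.
have yj : y j = x j - t by rewrite yE eqxx eq_sym (negPf ij) sub0r mulrN1.
have yk k : k != i -> k != j -> y k = x k.
  by move=> ki kj; rewrite yE (negPf ki) (negPf kj) subrr mulr0 addr0.
exists t; rewrite -/y; split=> //; first by apply: le_lt_trans tj xj1.
  split; last by rewrite /= sum_setT sum_swap !inE subrr mulr0 addr0 -sum_setT.
  move=> k; have [->|ki] := eqVneq k i; first by rewrite yi; apply/andP; split; lra.
  have [->|kj] := eqVneq k j; first by rewrite yj; apply/andP; split; lra.
  by rewrite yk.
have sub : frac y \subset frac x.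
  apply/subsetP => k; rewrite !inE.
  have [->|ki] := eqVneq k i; first by rewrite xi0 xi1.
  have [->|kj] := eqVneq k j; first by rewrite xj0 xj1.
  by rewrite yk.
apply: proper_card; apply/properP; split=> //; case: tE => tE; [exists i|exists j];
  rewrite !inE ?xi0 ?xi1 ?xj0 ?xj1 //; apply/negP => /andP[].
  by rewrite yi tE addrC subrK ltxx.
by rewrite yj -tE subrr ltxx.
Qed.

(* The hypersimplex can be moved along e_i - e_j in both directions at two fractional
   coordinates i, j.  If i and j lie on the same side of F this keeps the sum over F;
   otherwise i and j are the only fractional coordinates, and the two endpoints are
   0/1 points whose sums over F are integers smaller than s + 1. *)
Lemma half_integral d F s x : half_hypersimplex d F s x ->
  conv (half_hypersimplex d F s `&` vertices) x.
Proof.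
have [n] := ubnP #|frac x|; elim: n x => // n IH x /ltnSE ltn [dx sx].
have [f0|/set0Pn[i0 fi0]] := eqVneq (frac x) set0.
  have [B eB] := frac0 dx f0; apply: sub_conv; split; first by [].
  by rewrite eB; exists B.
have [i [j [ij fi fj hs]]] : exists i j, [/\ i != j, i \in frac x, j \in frac x &
    (i \in F) = (j \in F) \/ (#|frac x| <= 2)%N].
  have [[i [j [ij fi fj eF]]]|nex] :=
    pselect (exists i j, [/\ i != j, i \in frac x, j \in frac x & (i \in F) = (j \in F)]).
    by exists i, j; split=> //; left.
  have [j ji fj] := frac_second dx fi0.
  exists i0, j; split=> //; first by rewrite eq_sym.
  right; suff /subset_leq_card : frac x \subset [set i0; j]%SET by rewrite cards2 eq_sym ji.
  apply/subsetP => k fk; rewrite !inE; apply: contraT; rewrite negb_or => /andP[ki kj].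
  case: nex; have [eF|nF] := eqVneq (k \in F) (i0 \in F); first by exists k, i0.
  have [eF|nF'] := eqVneq (k \in F) (j \in F); first by exists k, j.
  exists i0, j; split=> //; first by rewrite eq_sym.
  by move: nF nF'; case: (k \in F); case: (i0 \in F); case: (j \in F).
have aux k l (t : R) : k != l -> (k \in F) = (l \in F) \/ (#|frac x| <= 2)%N ->
    0 < t -> t < 1 -> hypersimplex d (x + t *: (e k - e l)) ->
    (#|frac (x + t *: (e k - e l))%R| < #|frac x|)%N -> 
    conv (half_hypersimplex d F s `&` vertices) (x + t *: (e k - e l)).
  move=> kl hF t0 t1 dy ly; apply: IH; first exact: leq_trans ly ltn.
  split=> //=; case: hF => [eF|le2]; first by rewrite sum_swap eF subrr mulr0 addr0.
  have [|B eB] := frac0 dy.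
    apply/eqP; apply: contraT => /set0Pn[a fa]; have [b ba fb] := frac_second dy fa.
    have : [set a; b]%SET \subset frac (x + t *: (e k - e l))%R.
      by rewrite subUset !sub1set fa fb.
    by move/subset_leq_card; rewrite cards2 eq_sym ba; move: ly le2; clear; lia.
  have := sum_swap F x t k l; rewrite eB sum_charvec => eS; rewrite ler_nat -ltnS -(ltr_nat R) eS.
  rewrite mulrS [1 + _]addrC; apply: (ler_ltD sx); apply: le_lt_trans t1.
  rewrite -[leRHS]mulr1; apply: ler_wpM2l; first exact: ltW.
  by case: (k \in F); case: (l \in F); rewrite /= ?mulr1n ?mulr0n; lra.
have [t [t0 t1 dy ly]] := push dx ij fi fj.
have ji : j != i by rewrite eq_sym.
have [t' [t0' t1' dz lz]] := push dx ji fj fi.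
have cy := aux i j t ij hs t0 t1 dy ly.
have cz : conv (half_hypersimplex d F s `&` vertices) (x + t' *: (e j - e i)).
  by apply: aux => //; case: hs; [left|right].
have tt : t + t' != 0 by rewrite gt_eqF // addr_gt0.
(* With this weight the opposite displacements [t] and [t'] cancel. *)
have : 0 <= t' / (t + t') <= 1.
  have t01 := ltW t0; have t01' := ltW t0'; rewrite divr_ge0 ?addr_ge0 //=.
  by rewrite ler_pdivrMr ?addr_gt0 // mul1r lerDr.
move/conv_line/(_ cy cz); congr (conv _ _).
by apply/ffunP => k; rewrite !ffunE /GRing.scale /=; field.
Qed.

End Integrality.

(** * Faces of polytopes with 0/1 vertices *)

Section Faces.
Local Open Scope ring_scope.
Local Open Scope classical_set_scope.
Variables (R : realType) (T : finType).
Local Notation E := {ffun T -> R^o}.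
Local Notation vertices := (range (@charvec R T)).
Implicit Types (K Q : set E) (x y z p l : E).

Lemma faceP K Q : face K Q <-> exists l (c : R),
  (forall x, K x -> dot l x <= c) /\ Q = K `&` [set x | dot l x = c].
Proof. by []. Qed.

Lemma face_sub K Q : face K Q -> Q `<=` K.
Proof. by move=> /faceP[l [c [_ ->]]] x []. Qed.

Lemma face_refl K : face K K.
Proof.
apply/faceP; exists 0, 0; have d0 x : dot 0 x = 0.
  by rewrite /dot big1 // => i _; rewrite ffunE mul0r.
split=> [x _|]; first by rewrite d0.
by apply/seteqP; split=> x; [move=> Kx; split; rewrite //= d0 | case].
Qed.

Lemma face_cap K Q Q' : Q `<=` K -> face K Q' -> face Q (Q `&` Q').
Proof.
move=> QK /faceP[l [c [lc ->]]]; apply/faceP; exists l, c; split=> [x /QK /lc //|].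
apply/seteqP; split=> x; first by move=> [Qx [_ e]].
by move=> [Qx e]; split=> //; split=> //; apply: QK.
Qed.

(** Such sets are determined by their 0/1 points, hence finite in number, and the property passes to
    faces; this controls the cells of a subdivision. *)
Definition integral K := K = conv (K `&` vertices).

Lemma face_integral K Q : integral K -> face K Q -> integral Q.
Proof.
move=> iK /faceP[l [c [lc eQ]]]; apply/seteqP; split=> x.
  rewrite {1}eQ => -[Kx e]; rewrite iK in Kx.
  have h y : (K `&` vertices) y -> dot l y <= c by move=> [/lc].
  have := conv_face h Kx e; apply: conv_mono => y [[Ky vy] ey].
  by rewrite eQ.
move=> hx; rewrite eQ; split.
  by rewrite iK; move: hx; apply: conv_mono => y []; rewrite eQ => -[].
apply/eqP; rewrite eq_le; apply/andP; split.
  by move: hx; apply: conv_le => y []; rewrite eQ => -[/lc].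
by move: hx; apply: conv_ge => y []; rewrite eQ => -[_ /= ->].
Qed.

Lemma integral_ext K Q : integral K -> integral Q ->
  (forall B, K (charvec R B) <-> Q (charvec R B)) -> K = Q.
Proof.
move=> iK iQ h; suff e : K `&` vertices = Q `&` vertices by rewrite iK e -iQ.
by apply/seteqP; split=> x [hx [B _ eB]]; split; try (by exists B); move: hx;
  rewrite -eB => /h.
Qed.

(* For N large enough the functional N l + l' cuts Q' out of K. *)
Lemma face_trans K Q Q' : integral K -> face K Q -> face Q Q' -> face K Q'.
Proof.
move=> iK fQ fQ'; have iQ := face_integral iK fQ; have iQ' := face_integral iQ fQ'.
move: (fQ) (fQ') => /faceP[l [c [lc eQ]]] /faceP[l' [c' [lc' eQ']]].
pose gap B := c - dot l (charvec R B).
(* Dominates the ratio for every 0/1 vector with positive gap; the summand 1 makes the domination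
   strict. *)
pose N : R := 1 + \sum_(B : {set T} | 0 < gap B) `|dot l' (charvec R B) - c'| / gap B.
have hN B : 0 < gap B -> dot l' (charvec R B) - c' < N * gap B.
  move=> gB; apply: le_lt_trans (ler_norm _) _; rewrite -ltr_pdivrMr // /N (bigD1 B) //=.
  rewrite addrCA ltrDl; apply: ltr_wpDr ltr01; apply: sumr_ge0 => B' /andP[gB' _].
  by rewrite divr_ge0 // ltW.
have key B : K (charvec R B) ->
    dot (N *: l + l') (charvec R B) <= N * c + c' /\
    (dot (N *: l + l') (charvec R B) = N * c + c' <-> Q' (charvec R B)).
  move=> KB; rewrite dotDl dotZl.
  have [gB|gB] := ltP 0 (gap B).
    have lt : N * dot l (charvec R B) + dot l' (charvec R B) < N * c + c'.
      by have := hN B gB; rewrite /gap; lra.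
    split; [exact: ltW | split=> [e|]; first by rewrite e ltxx in lt].
    by rewrite eQ' eQ => -[[_ /= e] _]; move: gB; rewrite /gap e subrr ltxx.
  have eB : dot l (charvec R B) = c.
    by apply/eqP; rewrite eq_le lc //=; move: gB; rewrite /gap subr_le0.
  have QB : Q (charvec R B) by rewrite eQ.
  rewrite eB; split; first by rewrite lerD2l lc'.
  by rewrite eQ'; split=> [/addrI|[_ /= ->]].
have le x : K x -> dot (N *: l + l') x <= N * c + c'.
  by rewrite iK; apply: conv_le => y [KB [B _ eB]]; rewrite -eB in KB *; case: (key B KB).
have fK : face K (K `&` [set x | dot (N *: l + l') x = N * c + c']).
  by apply/faceP; exists (N *: l + l'), (N * c + c').
suff <- : K `&` [set x | dot (N *: l + l') x = N * c + c'] = Q' by [].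
apply: integral_ext => //; first exact: face_integral iK fK.
move=> B; split=> [[KB /=]|QB]; first by case: (key B KB) => _ [h _] /h.
have KB : K (charvec R B) by apply: (face_sub fQ); apply: (face_sub fQ').
by split=> //=; apply/(key B KB).2.
Qed.

Lemma integral_polytope K : integral K -> polytope K.
Proof.
move=> iK; exists (K `&` vertices) => //; apply: (@sub_finite_set _ _ vertices).
  by move=> x [].
by apply: finite_image; exact: finite_finset.
Qed.

Lemma integral_finite : finite_set [set K | integral K].
Proof.
pose f (V : set {set T}) : set E := conv [set charvec R B | B in V].
apply: (@sub_finite_set _ _ (range (fun V : {set {set T}} => f [set` V]))).
  move=> K iK; exists [set B | `[< K (charvec R B) >]]%SET => //.
  rewrite /f [RHS]iK; congr conv; apply/seteqP; split=> x.
    by move=> [B /=]; rewrite inE => /asboolP KB <-; split=> //; exists B.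
  by move=> [Kx [B _ eB]]; exists B => //=; rewrite inE; apply/asboolP; rewrite eB.
by apply: finite_image; exact: finite_finset.
Qed.

Lemma integral_vertex K x : integral K -> vertex K x -> vertices x.
Proof.
move=> iK fx; have := face_integral iK fx => /seteqP[/(_ x erefl)].
move=> [[|k] [c [p [hp _ c1 _]]]] _.
  by move: c1; rewrite big_ord0 => /eqP; rewrite eq_sym oner_eq0.
by have [-> ] := hp ord0.
Qed.

(** The functional that is 1 on [B] and -1 off [B] is maximal over the cube at this point only,
    coordinate by coordinate. *)
Lemma cube_vertex K B : K `<=` @cube R T -> K (charvec R B) -> vertex K (charvec R B).
Proof.
move=> Kc KB; pose l := charvec R B - charvec R (~: B).
have term x i : K x -> l i * x i <= l i * charvec R B i ?= iff (x i == charvec R B i).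
  move=> /Kc /(_ i) /andP[x0 x1]; rewrite /l !ffunE inE; case: (i \in B) => /=.
    by rewrite subr0 !mul1r; split=> //.
  rewrite sub0r mulr0 mulN1r; split; first by rewrite oppr_le0.
  by rewrite oppr_eq0.
have sum x : K x -> dot l x <= dot l (charvec R B) ?= iff [forall i, x i == charvec R B i].
  by move=> Kx; apply: leif_sum => i _; apply: term.
apply/faceP; exists l, (dot l (charvec R B)); split=> [x /sum /leifP|].
  by case: ifP => _; [move/eqP->|move/ltW].
apply/seteqP; split=> x /=; first by move=> ->.
move=> [/sum[_ e0] /eqP]; rewrite e0 => /forallP h; apply/ffunP => i; exact/eqP.
Qed.

Lemma ex_pos_lb (I : finType) (f : I -> R) : (forall i, 0 < f i) ->
  exists2 t : R, 0 < t & forall i, t <= f i.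
Proof.
move=> f0; pose N := 1 + \sum_i (f i)^-1.
have N0 : 0 < N by apply: ltr_wpDr ltr01; apply: sumr_ge0 => i _; rewrite invr_ge0 ltW.
exists N^-1; first by rewrite invr_gt0.
move=> i; rewrite -[leRHS]invrK lef_pV2 ?posrE ?invr_gt0 //.
rewrite /N (bigD1 i) //= addrCA lerDl; apply: addr_ge0 ler01 _.
by apply: sumr_ge0 => j _; rewrite invr_ge0 ltW.
Qed.

Lemma cube_interior p y : (forall i, 0 < p i < 1) ->
  exists2 t : R, 0 < t & cube (p + t *: (y - p)).
Proof.
move=> hp; have [|t t0 ht] := @ex_pos_lb T (fun i => Num.min (p i) (1 - p i) / (1 + `|y i - p i|)).
  move=> i; have /andP[p0 p1] := hp i; rewrite divr_gt0 ?lt_min ?p0 ?subr_gt0 //.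
  exact: ltr_wpDr ltr01.
exists t => // i; have := ht i; rewrite ler_pdivlMr ?(ltr_wpDr _ ltr01) // mulrDr mulr1.
have <- : `|t * (y i - p i)| = t * `|y i - p i| by rewrite normrM (gtr0_norm t0).
rewrite le_min !ffunE /GRing.scale /= => /andP[].
have := ler_norm (t * (y i - p i)); have := ler_norm (- (t * (y i - p i))); rewrite normrN.
by move: t0; set v := t * _; set w := `|_| => *; apply/andP; split; lra.
Qed.

(** A short step from [p] towards [y] stays in the cube, hence in [S], and the line through both
    points reaches [y]. *)
Lemma aff_interior S p y : S p -> (forall t : R, 0 < t -> cube (p + t *: (y - p)) ->
  S (p + t *: (y - p))) -> (forall i, 0 < p i < 1) -> aff S y.
Proof.
move=> Sp hS hp; have [t t0 ct] := cube_interior y hp.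
have := aff_add t^-1 (sub_aff (hS t t0 ct)) (sub_aff Sp) (sub_aff Sp).
rewrite addrAC subrr add0r scalerA mulVf ?gt_eqF // scale1r.
by rewrite addrC subrK.
Qed.

End Faces.

(** * The subdivision of the hypersimplex into two halves *)

Section HypersimplexSplit.
Local Open Scope ring_scope.
Local Open Scope classical_set_scope.
Variables (R : realType) (T : finType).
Local Notation E := {ffun T -> R^o}.
Local Notation vertices := (range (@charvec R T)).
Local Notation e i := (charvec R [set i]%SET).
Variables (F : {set T}) (d r : nat).
Hypotheses (r0 : (0 < r)%N) (rF : (r < #|F|)%N) (rd : (r < d)%N) (dF : (d - r < #|~: F|)%N).
Implicit Types (K Q : set E) (x y z p l : E).

Let Delta := @hypersimplex R T d.
Let A := @half_hypersimplex R T d F r.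
(** The upper half, written through the complement of [F] so that one integrality proof covers both
    halves. *)
Let B := @half_hypersimplex R T d (~: F) (d - r).
Let W := Delta `&` [set x | \sum_(i in F) x i = r%:R].

Let sumC x : Delta x -> \sum_(i in ~: F) x i = d%:R - \sum_(i in F) x i.
Proof.
move=> [_ /= <-]; rewrite [X in _ = X - _]sum_setT (sumID _ F) setTI setTD.
by rewrite addrC addKr.
Qed.

Let BE x : B x <-> Delta x /\ r%:R <= \sum_(i in F) x i.
Proof.
split=> -[Dx /= h]; split=> //=; move: h; rewrite sumC // natrB ?(ltnW rd) //; lra.
Qed.

Let AB : A `&` B = W.
Proof.
apply/seteqP; split=> x.
  by move=> [[Dx h1] /BE[_ h2]]; split=> //; apply/eqP; rewrite eq_le h1.
move=> [Dx /= h]; split; first by split; rewrite //= h.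
by apply/BE; rewrite h.
Qed.

Let face_A : face A W.
Proof.
apply/faceP; exists (charvec R F), r%:R; split=> [x [_ /=]|]; first by rewrite dot_charvec.
apply/seteqP; split=> x.
  by move=> [Dx /= h]; rewrite /= dot_charvec; split=> //; split; rewrite //= h.
by move=> [[Dx _]]; rewrite /= dot_charvec.
Qed.

Let face_B : face B W.
Proof.
apply/faceP; exists (charvec R (~: F)), (d - r)%:R.
split=> [x [_ /=]|]; first by rewrite dot_charvec.
apply/seteqP; split=> x.
  move=> Wx; have := Wx; rewrite -AB => -[_ Bx]; split=> //=.
  by case: Wx => Dx /= h; rewrite dot_charvec sumC // h natrB // ltnW.
move=> [[Dx _]]; rewrite /= dot_charvec sumC // natrB ?(ltnW rd) // => h; split=> //=.
by move: h; lra.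
Qed.

Let half_int (G : {set T}) s : integral (@half_hypersimplex R T d G s).
Proof.
apply/seteqP; split=> x; first exact: half_integral.
move=> hx; split; last first.
  by move: hx; rewrite /= -dot_charvec; apply: conv_le => y [[_ h] _]; rewrite dot_charvec.
split=> [i|].
  apply/andP; split.
    have -> : x i = dot (e i) x by rewrite dot_charvec big_set1.
    move: hx; apply: conv_ge => y [[[/(_ i)/andP[h _] _] _] _].
    by rewrite dot_charvec big_set1.
  have -> : x i = dot (e i) x by rewrite dot_charvec big_set1.
  move: hx; apply: conv_le => y [[[/(_ i)/andP[_ h] _] _] _].
  by rewrite dot_charvec big_set1.
rewrite /= sum_setT -dot_charvec; apply/eqP; rewrite eq_le; apply/andP; split.
  by move: hx; apply: conv_le => y [[[_ /= h] _] _]; rewrite dot_charvec -sum_setT h.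
by move: hx; apply: conv_ge => y [[[_ /= h] _] _]; rewrite dot_charvec -sum_setT h.
Qed.

Let iA : integral A. Proof. exact: half_int. Qed.
Let iB : integral B. Proof. exact: half_int. Qed.

(** Spreads [r] evenly over [F] and [d - r] over its complement; the strict hypotheses on [r] and
    [d] put this point of the hyperplane in the interior of the cube. *)
Let p : E := [ffun i => if i \in F then r%:R / #|F|%:R else (d - r)%:R / #|~: F|%:R].

Let pE i : 0 < p i < 1.
Proof.
have h (a b : nat) : (0 < a < b)%N -> 0 < (a%:R / b%:R : R) < 1.
  move=> /andP[a0 ab]; have b0 : (0 < b)%N by apply: leq_trans ab.
  by rewrite divr_gt0 ?ltr0n // ltr_pdivrMr ?ltr0n // mul1r ltr_nat ab.
by rewrite ffunE; case: (i \in F); apply: h; rewrite ?r0 // subn_gt0 rd.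
Qed.

Let sum_const (G : {set T}) (a : nat) : (0 < #|G|)%N ->
  \sum_(i in G) (a%:R / #|G|%:R : R) = a%:R.
Proof.
move=> G0; rewrite sumr_const -(mulr_natr (_ / _)) divfK // pnatr_eq0; move: G0; by case: #|_|.
Qed.

Let pF : \sum_(i in F) p i = r%:R.
Proof.
rewrite -[RHS](sum_const r (leq_trans _ rF)) //; apply: eq_bigr => i iF.
by rewrite ffunE iF.
Qed.

Let pT : \sum_i p i = d%:R.
Proof.
rewrite sum_setT (sumID _ F) setTI setTD pF.
suff -> : \sum_(i in ~: F) p i = (d - r)%:R by rewrite -natrD subnKC // ltnW.
rewrite -[RHS](@sum_const (~: F) (d - r)) ?(leq_trans _ dF) //.
by apply: eq_bigr => i; rewrite inE ffunE => /negPf ->.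
Qed.

Let pD : Delta p.
Proof.
split=> // i; have /andP[h1 h2] := pE i; by rewrite !ltW.
Qed.

Let pW : W p. Proof. by split. Qed.

Let affD x : aff Delta x <-> \sum_i x i = d%:R.
Proof.
split=> [|ex].
  by rewrite sum_setT -dot_charvec; apply: aff_eq => y [_ /= ey]; rewrite dot_charvec -sum_setT.
apply: (aff_interior pD) pE => t t0 ct; split=> //=.
by rewrite sum_setT sumD sumZ sumB -!sum_setT ex pT subrr mulr0 addr0.
Qed.

Let affW x : aff W x <-> \sum_i x i = d%:R /\ \sum_(i in F) x i = r%:R.
Proof.
split=> [hx|[ex eF]].
  split; first by apply/affD; move: hx; apply: aff_mono => y [].
  by move: hx; rewrite -dot_charvec; apply: aff_eq => y [_ /= ey]; rewrite dot_charvec.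
apply: (aff_interior pW) pE => t t0 ct; split; last first.
  by rewrite /= sumD sumZ sumB eF pF subrr mulr0 addr0.
by split=> //=; rewrite sum_setT sumD sumZ sumB -!sum_setT ex pT subrr mulr0 addr0.
Qed.

Let ij : exists i j, [/\ i \in F, j \notin F & i != j].
Proof.
have /card_gt0P[i iF] : (0 < #|F|)%N by apply: leq_trans rF.
have /card_gt0P[j] : (0 < #|~: F|)%N by apply: leq_trans dF.
rewrite inE => jF; exists i, j; split=> //.
by apply: contraNneq jF => <-.
Qed.

Let push_p (i j : T) : i != j -> exists2 t : R, 0 < t & Delta (p + t *: (e i - e j)).
Proof.
move=> nij; have [t t0 ct] := cube_interior (p + (e i - e j)) pE.
exists t => //; rewrite addrAC subrr add0r in ct; split=> //=.
by rewrite sum_setT sum_swap !inE subrr mulr0 addr0 -sum_setT.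
Qed.

Let nAB : ~ A `<=` B.
Proof.
have [i [j [iF jF nij]]] := ij; rewrite eq_sym in nij.
have [t t0 Dt] := push_p nij.
have e1 := sum_swap F p t j i; rewrite iF (negPf jF) pF sub0r mulrN1 in e1.
move/(_ (p + t *: (e j - e i))); case=> [|_ /=].
  by split=> //=; rewrite e1 gerBl ltW.
by rewrite sumC // e1 natrB ?(ltnW rd) //; lra.
Qed.

Let nBA : ~ B `<=` A.
Proof.
have [i [j [iF jF nij]]] := ij; have [t t0 Dt] := push_p nij.
have e1 := sum_swap F p t i j; rewrite iF (negPf jF) pF subr0 mulr1 in e1.
move/(_ (p + t *: (e i - e j))); case=> [|_ /=].
  by apply/BE; split=> //=; rewrite e1 lerDl ltW.
by rewrite e1; lra.
Qed.

Let dims : exists2 k, has_dim W k & has_dim Delta k.+1.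
Proof.
pose UD : {vspace E} := lker (linfun (dot (charvec R [set: T]%SET))).
pose UW : {vspace E} := (UD :&: lker (linfun (dot (charvec R F))))%VS.
have UDP u : u \in UD = (\sum_i u i == 0).
  by rewrite memv_ker lfunE /= dot_charvec -sum_setT.
have UWP u : u \in UW = (\sum_i u i == 0) && (\sum_(i in F) u i == 0).
  by rewrite memv_cap UDP memv_ker lfunE /= dot_charvec.
have [i [j [iF jF _]]] := ij.
have sumBp x : \sum_k (x - p) k = \sum_k x k - d%:R.
  by rewrite (sum_setT (x - p)) sumB -!sum_setT pT.
have e0 G := sum_swap G (0 : E) 1 i j.
have eD : e i - e j \in UD.
  rewrite UDP sum_setT sumB !sum_charvec !setIT !cards1 subrr; exact: eqxx.
have eF : dot (charvec R F) (e i - e j) != 0.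
  have := e0 F; rewrite iF (negPf jF) scale1r add0r mul1r subr0 dot_charvec => ->.
  by rewrite big1 ?add0r ?oner_neq0 // => k _; rewrite ffunE.
exists (\dim UW).
  apply: (has_dim_aff pW) => x; rewrite affW UWP sumBp sumB pF !subr_eq0.
  split; first by move=> [-> ->]; rewrite !eqxx.
  by move=> /andP[/eqP -> /eqP ->].
rewrite -(dim_capv_lker eD eF); apply: (has_dim_aff pD) => x.
rewrite affD UDP sumBp subr_eq0.
by split=> [->|/eqP].
Qed.

(** Faces of different halves can meet only in [W], so [Q'] cuts a face out of [Q :&: W], itself a
    face of [Q]; transitivity of faces concludes. *)
Let face_cross K K' Q Q' : integral K -> K `&` K' = W -> face K W ->
  face K Q -> face K' Q' -> face Q (Q `&` Q').
Proof.
move=> iK eW fW fQ fQ'; have QK := face_sub fQ.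
have f1 : face Q (Q `&` W) by exact: face_cap QK fW.
have QW : Q `&` W `<=` K' by rewrite -eW => x [_ []].
have f2 := face_cap QW fQ'.
have <- : Q `&` W `&` Q' = Q `&` Q'.
  apply/seteqP; split=> x; first by move=> [[Qx _] Qx'].
  move=> [Qx Qx']; split=> //; split=> //; rewrite -eW; split; first exact: QK.
  exact: (face_sub fQ').
exact: face_trans (face_integral iK fQ) f1 f2.
Qed.

(** The cells are all the faces of both halves. Their vertices are 0/1 points, hence vertices of the
    hypersimplex. Only the trace of [H] on the slice of coordinate sum [d] matters, which admits the
    homogeneous equation of a flat. *)
Lemma hypersimplex_split (H : set E) :
  (forall x, \sum_i x i = d%:R -> (H x <-> \sum_(i in F) x i = r%:R)) ->
  defines_split (@hypersimplex R T d) H.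
Proof.
move=> hH; pose Sigma : set (set E) := [set Q | face A Q \/ face B Q].
have SA : Sigma A by left; exact: face_refl.
have SB : Sigma B by right; exact: face_refl.
have iS Q : Sigma Q -> integral Q by case; exact: face_integral.
have SD Q : Sigma Q -> Q `<=` Delta.
  by case=> /face_sub QK x /QK; [case|move=> /BE[]].
exists Sigma, A, B; split.
- split; first by apply: sub_finite_set (@integral_finite R T) => Q /iS.
  split.
  + by move=> Q /iS /integral_polytope.
  + by move=> Q Q' [fQ|fQ] fQ'; [left|right]; apply: face_trans fQ fQ'.
  + have BA : B `&` A = W by rewrite classical_sets.setIC.
    move=> Q Q' [fQ|fQ] [fQ'|fQ'];
      (split; last rewrite classical_sets.setIC).
    * exact: face_cap (face_sub fQ) fQ'.
    * exact: face_cap (face_sub fQ') fQ.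
    * exact: (face_cross iA AB face_A fQ fQ').
    * exact: (face_cross iB BA face_B fQ' fQ).
    * exact: (face_cross iB BA face_B fQ fQ').
    * exact: (face_cross iA AB face_A fQ' fQ).
    * exact: face_cap (face_sub fQ) fQ'.
    * exact: face_cap (face_sub fQ') fQ.
  + apply/seteqP; split=> x; first by move=> [Q /SD h /h].
    move=> Dx; have [le|lt] := leP (\sum_(i in F) x i) r%:R; first by exists A.
    by exists B => //; apply/BE; rewrite ltW.
  + move=> Q x SQ vx; have [C _ eC] := integral_vertex (iS Q SQ) vx.
    rewrite -eC in vx *; apply: cube_vertex; first by move=> y [].
    apply: (SD Q SQ); exact: (face_sub vx).
- by move=> e0; apply: nAB; rewrite -e0.
- move=> Q; split=> [[SQ maxQ]|[->|->]].
    by case: (SQ) => fQ; [left|right]; rewrite (maxQ _ _ (face_sub fQ)).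
  + split=> // Q' [fQ'|fQ'] AQ'; first by apply/seteqP; split=> //; exact: face_sub.
    by case: nAB; move=> x /AQ' /(face_sub fQ').
  + split=> // Q' [fQ'|fQ'] BQ'; last by apply/seteqP; split=> //; exact: face_sub.
    by case: nBA; move=> x /BQ' /(face_sub fQ').
- by rewrite AB; exact: dims.
- rewrite AB; apply/seteqP; split=> x.
    by move=> /affW[ex eF]; split; [apply/hH | apply/affD].
  by move=> [Hx /affD ex]; apply/affW; split=> //; apply/hH.
Qed.

End HypersimplexSplit.

(** * Relative interior points *)

Section RelativeInterior.
Local Open Scope ring_scope.
Local Open Scope classical_set_scope.
Variables (R : realType) (T : finType) (M : matroid T).
Local Notation E := {ffun T -> R^o}.
Implicit Types (x y z : E) (A B C F G S : {set T}).
Local Notation P := (@matroid_polytope R T M).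
Local Notation e i := (charvec R [set i]%SET).
Local Notation L := (loops M).
Local Notation r := (rank M).
Local Notation section := (aff P `&` @cube R T).

Lemma charvec_cube B : @cube R T (charvec R B).
Proof. by move=> i; rewrite ffunE; case: (i \in B); rewrite ?lexx ler01. Qed.

Lemma polytope_cube : P `<=` @cube R T.
Proof.
move=> x Px i; have xi : x i = dot (e i) x by rewrite dot_charvec big_set1.
rewrite xi; apply/andP; split; move: Px; [apply: conv_ge|apply: conv_le];
  move=> _ [B _ <-]; by rewrite dot_charvec big_set1; have /andP[] := charvec_cube B i.
Qed.

Lemma aff_section y : aff section y -> aff P y.
Proof.
move=> hy; apply/aff_polytope => S hS; rewrite -dot_charvec.
by apply: (aff_eq _ hy) => x [hx _]; rewrite dot_charvec; apply: aff_separator.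
Qed.

(** Shifting along [e i - e j] by half the radius in both senses must stay in the cube, which
    excludes the values 0 and 1. *)
Lemma relint_section_bounds x C i : relint section x -> component M C -> (1 < #|C|)%N ->
  i \in C -> 0 < x i < 1.
Proof.
move=> [[Px cx] [t t0 ht]] hC C1 iC.
have [j jC ji] : exists2 j, j \in C & j != i.
  by move: C1; rewrite (cardsD1 i) iC ltnS => /card_gt0P[j]; rewrite !inE => /andP[? ?]; exists j.
have PS : aff P `<=` aff section.
  by apply: aff_mono => y Py; split; [exact: sub_aff | exact: polytope_cube].
have move_x (s : R) : `|s| < t -> 0 <= x i + s <= 1.
  move=> st; pose y := x + s *: (e i - e j).
  have yE k : y k = x k + s * ((k == i)%:R - (k == j)%:R).
    by rewrite /y !ffunE !inE.
  have Py : aff P y.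
    apply/(aff_dirspace _ Px); rewrite addrAC subrr add0r; apply: memvZ.
    exact: dirspace_swap hC iC jC.
  have [k|_ /(_ i)] := ht y (PS _ Py); last by rewrite yE eqxx eq_sym (negPf ji) subr0 mulr1.
  rewrite yE addrAC subrr add0r normrM; apply: le_lt_trans st.
  rewrite -[leRHS]mulr1; apply: ler_wpM2l => //.
  by case: (k == i); case: (k == j); rewrite /= ?mulr1n ?mulr0n ?subrr ?subr0 ?sub0r ?normrN
    ?normr1 ?normr0 ?lexx ?ler01.
have t2 : `|t / 2| < t by rewrite gtr0_norm; lra.
have t2' : `|- (t / 2)| < t by rewrite normrN.
have /andP[_ h1] := move_x _ t2; have /andP[h2 _] := move_x _ t2'.
by apply/andP; split; lra.
Qed.

Lemma relint_section_intro x : aff P x ->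
  (forall i, ~~ separator M [set i] -> 0 < x i < 1) -> relint section x.
Proof.
move=> Px hx.
have sep1 y i : aff P y -> separator M [set i] -> 0 <= y i <= 1.
  move=> Py hi; have := aff_separator hi Py; rewrite big_set1 => ->.
  by rewrite ler0n -[X in _ <= X]/(1%:R) ler_nat; have := rank_card M [set i]; rewrite cards1.
split.
  split=> // i; have [hi|hi] := boolP (separator M [set i]); first exact: sep1.
  by have /andP[h1 h2] := hx i hi; rewrite !ltW.
have [|t t0 ht] := @ex_pos_lb R T
  (fun i => if separator M [set i] then 1 else Num.min (x i) (1 - x i)).
  by move=> i; case: ifPn => [//|/hx /andP[h1 h2]]; rewrite lt_min h1 subr_gt0.
exists t => // y hy hd; have Py := aff_section hy; split=> // i.
have [hi|hi] := boolP (separator M [set i]); first exact: sep1.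
have := ht i; rewrite (negPf hi) le_min => /andP[h1 h2].
by have := hd i; rewrite ltr_norml => /andP[h3 h4]; apply/andP; split; lra.
Qed.

(** The average of all bases: an element that is neither a loop nor a coloop lies in some basis and
    is missed by another. *)
Lemma barycenter : exists2 b, P b & forall i, ~~ separator M [set i] -> 0 < b i < 1.
Proof.
pose V := [set B | basis M B]%SET; pose K : R := #|V|%:R.
have [B0 hB0] := basis_witness M.
have K0 : 0 < K by rewrite ltr0n; apply/card_gt0P; exists B0; rewrite inE.
pose b : E := \sum_(k < #|V|) K^-1 *: charvec R (enum_val k).
have bE i : b i = K^-1 * \sum_(B in V) (i \in B)%:R.
  rewrite sum_ffunE mulr_sumr [RHS]big_enum_val; apply: eq_bigr => k _.
  by rewrite !ffunE.
have K1 : 1 = K^-1 * \sum_(B in V) 1 :> R by rewrite sumr_const mulVf // gt_eqF.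
exists b.
  exists #|V|, (fun=> K^-1), (fun k => charvec R (enum_val k)); split=> //.
  - by move=> k; exists (enum_val k) => //; have := enum_valP k; rewrite inE.
  - by move=> k; rewrite invr_ge0 ltW.
  - by rewrite sumr_const card_ord -(mulr_natr K^-1) mulVf // gt_eqF.
move=> i; rewrite separator1 negb_or -leqNgt => /andP[nl nc].
have [B1 hB1 iB1] : exists2 B, basis M B & i \in B.
  have [|B hB] := @basis_extend _ M [set i]; last by rewrite sub1set; exists B.
  by rewrite indep_card cards1; have := rank_card M [set i]; rewrite cards1; move: nl; clear; lia.
have [B2 hB2 iB2] : exists2 B, basis M B & i \notin B.
  have [B [Bi hB cB]] := rank_witness M (~: [set i]).
  exists B; last by apply/negP => /(subsetP Bi); rewrite !inE eqxx.
  by rewrite basisE hB cB eqn_leq nc rankS // subsetT.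
rewrite bE; apply/andP; split.
  rewrite mulr_gt0 ?invr_gt0 // (bigD1 B1) /=; last by rewrite inE.
  by rewrite iB1; apply: ltr_wpDr ltr01; apply: sumr_ge0 => B _; exact: ler0n.
rewrite [ltRHS]K1 ltr_pM2l ?invr_gt0 // (bigD1 B2) /=; last by rewrite inE.
rewrite [ltRHS](bigD1 B2) /=; last by rewrite inE.
rewrite (negPf iB2); apply: ltr_leD; first exact: ltr01.
by apply: ler_sum => B _; case: (i \in B); rewrite ?lexx ?ler01.
Qed.

Definition glue C x y : E := [ffun i => if i \in C then x i else y i].

Lemma sum_glue C x y A :
  \sum_(i in A) glue C x y i = \sum_(i in A :&: C) x i + \sum_(i in A :\: C) y i.
Proof.
rewrite (sumID A C); congr (_ + _); apply: eq_bigr => i; rewrite inE ffunE.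
  by case/andP=> _ ->.
by case/andP=> /negPf ->.
Qed.

(** Each separator equation splits along [C]. Only separators inside [C] constrain [x], so it may be
    any extension of a point of the restriction. *)
Lemma aff_glue C x y : separator M C -> 
  (forall S, S \subset C -> separator M S -> \sum_(i in S) x i = (r S)%:R) -> aff P y ->
  aff P (glue C x y).
Proof.
move=> hC hx hy; apply/aff_polytope => S hS.
rewrite sum_glue (hx _ (subsetIr S C)); last exact: separatorI.
by rewrite (aff_separator (separatorD hS hC) hy) -natrD -separator_rank.
Qed.

(** On this slice the homogeneous equation is the plain one multiplied by the total rank, which is
    cancelled. *)
Lemma hyperplaneE F x : \sum_i x i = (r [set: T])%:R -> (0 < r [set: T])%N ->
  flat_hyperplane M F x <-> \sum_(i in F) x i = (r F)%:R.
Proof.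
move=> sx r0; have rF := rankS M (subsetT F).
have eC : \sum_(i in ~: F) x i = (r [set: T])%:R - \sum_(i in F) x i.
  rewrite -sx [X in _ = X - _]sum_setT (sumID [set: T]%SET F) setTI setTD.
  by rewrite addrC addKr.
rewrite /flat_hyperplane /= eC natrB //; set a := \sum_(i in F) x i.
have n0 : (r [set: T])%:R != 0 :> R by rewrite pnatr_eq0 -lt0n.
split=> [h|->]; last by ring.
by apply: (mulfI n0); move: h; lra.
Qed.

Lemma sum_lt A (f g : T -> R) : A != set0 -> (forall i, i \in A -> f i < g i) ->
  \sum_(i in A) f i < \sum_(i in A) g i.
Proof.
move=> /set0Pn[i iA] h; rewrite (bigD1 i) //= [ltRHS](bigD1 i) //=.
by apply: ltr_leD; [exact: h | apply: ler_sum => j /andP[/h /ltW]].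
Qed.

(** Each inequality compares a sum of coordinates over [F] or [C :\: F] with the sum of as many
    zeros or ones. This recovers the hypotheses of [hypersimplex_split] from a common interior
    point. *)
Lemma interior_ranks C F x : F \subset C -> F != set0 -> F != C ->
  (forall i, i \in C -> 0 < x i < 1) -> \sum_(i in C) x i = (r C)%:R ->
  \sum_(i in F) x i = (r F)%:R ->
  [/\ (r F < #|F|)%N, (r F < r C)%N & (r C - r F < #|C :\: F|)%N].
Proof.
move=> FC F0 FnC hx xC xF.
have D0 : C :\: F != set0.
  by rewrite setD_eq0; apply: contra FnC => CF; rewrite eqEsubset FC.
have xD : \sum_(i in C :\: F) x i = (r C)%:R - (r F)%:R.
  by rewrite -xC (sumID C F) (setIidPr FC) xF addrC addKr.
have card A : \sum_(i in A) 1 = #|A|%:R :> R by rewrite sumr_const.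
have rFC : (r F < r C)%N.
  rewrite -(ltr_nat R) -subr_gt0 -xD.
  have := @sum_lt (C :\: F) (fun=> 0) x D0; rewrite big1_eq; apply.
  by move=> i /setDP[/hx /andP[]].
split=> //.
  by rewrite -(ltr_nat R) -xF -card; apply: sum_lt => // i /(subsetP FC) /hx /andP[].
rewrite -(ltr_nat R) natrB ?(ltnW rFC) // -xD -card.
by apply: sum_lt => // i /setDP[/hx /andP[]].
Qed.

Lemma component_rank_gt0 C A : component M C -> (1 < #|C|)%N -> A \subset C ->
  A != set0 -> (0 < r A)%N.
Proof.
move=> hC C1 AC /set0Pn[i iA]; have := component_nosep1 hC C1 (subsetP AC i iA).
rewrite separator1 negb_or -lt0n => /andP[h _].
by apply: leq_trans h (rankS M _); rewrite sub1set.
Qed.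

Lemma split_flacet_lift C F : component M C -> (1 < #|C|)%N -> facial M C F ->
  (r F < #|F|)%N -> (r F < r C)%N -> (r C - r F < #|C :\: F|)%N ->
  split_flacet R M (F :|: L).
Proof.
move=> hC C1 hF h1 h2 h3; split; first exact: flacet_lift hC C1 hF.
have [FC F0 FnC _ _] := hF; have /componentP[_ sC _] := hC.
have r0 := component_rank_gt0 hC C1 FC F0.
have rT := separator_rank [set: T]%SET sC; rewrite setTI setTD in rT.
have rFT := rankUloops M F; have rL := rank_loops M.
(* The non-loops outside [C] still span there, so there are enough of them to keep the last
   inequality strict on the whole ground set. *)
have h4 : (r (~: C) <= #|~: C :\: L|)%N.
  have := rankU M (~: C :\: L) L; have := rank_card M (~: C :\: L).
  have : (r (~: C) <= r (~: C :\: L :|: L))%N.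
    apply: rankS; apply/subsetP => i iC; rewrite !inE -in_setC iC andbT.
    by rewrite orNb.
  by move: rL; clear; lia.
have h5 : (#|C :\: F| + #|~: C :\: L| <= #|~: (F :|: L)|)%N.
  rewrite -(cardsID C (~: (F :|: L))); apply: leq_add; apply: subset_leq_card; apply/subsetP => i.
    rewrite !inE => /andP[iF iC]; rewrite iC (negPf iF) /= andbT.
    by have := disjointFr (component_loops hC C1) iC; rewrite inE => ->.
  rewrite !inE => /andP[iL iC]; rewrite iC (negPf iL) orbF /=.
  by apply: contra iC; apply: (subsetP FC).
have h6 := subset_leq_card (subsetUl F L).
apply: (@hypersimplex_split R T (F :|: L) _ (r (F :|: L))).
- by rewrite rFT.
- by rewrite rFT; apply: leq_trans h6.
- by rewrite rFT rT; move: h2; clear; lia.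
- by rewrite rFT rT; move: h2 h3 h4 h5; clear; lia.
- by move=> x sx; apply: hyperplaneE => //; rewrite rT; move: h2; clear; lia.
Qed.

End RelativeInterior.

(** * Split matroids *)

Section SplitMatroid.
Local Open Scope ring_scope.
Local Open Scope classical_set_scope.
Variables (R : realType) (T : finType) (M : matroid T).
Local Notation E := {ffun T -> R^o}.
Implicit Types (x y z : E) (A B C D F G S : {set T}).
Local Notation P := (@matroid_polytope R T M).
Local Notation L := (loops M).
Local Notation r := (rank M).
Local Notation section := (aff P `&` @cube R T).

(* These are the sets F such that F :|: loops M is a split flacet of M whose hyperplane meets
   the relative interior of the section of the cube by aff P(M). *)
Definition proper_facial C F :=
  [/\ component M C, (1 < #|C|)%N, facial M C F &
      [/\ (r F < #|F|)%N, (r F < r C)%N & (r C - r F < #|C :\: F|)%N]].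

Lemma proper_facial_split C F : proper_facial C F -> split_flacet R M (F :|: L).
Proof. by move=> [hC C1 hF [h1 h2 h3]]; apply: (split_flacet_lift R hC C1 hF). Qed.

Lemma proper_facial_point C F : proper_facial C F ->
  exists y, [/\ aff P y, \sum_(i in F) y i = (r F)%:R & forall i, i \in C -> 0 < y i < 1].
Proof.
move=> [hC C1 hF [h1 h2 h3]]; have [FC F0 FnC _ pr] := hF.
have /componentP[_ sC _] := hC.
have r0 := component_rank_gt0 hC C1 FC F0.
have [y Py hy] := barycenter R (face_matroid M (F :|: L)).
rewrite -flat_faceE in Py; case: Py => Py eF; exists y; split; first exact: sub_aff.
  move: eF; rewrite /= rankUloops sumUloops; last exact: disjointWl FC (component_loops hC C1).
  by rewrite (aff_separator (separator_loops M) (sub_aff Py)) rank_loops addr0.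
move=> i iC; apply: hy; apply/negP => hs.
have [e1 e2 _] := separator_face_lift sC FC hs.
have := pr _ (subsetIr _ _) e1 e2; rewrite (setIidPl _) ?sub1set // !inE.
by case/or4P => /eqP e3; have := cards1 i; rewrite e3 ?cards0 //; move: r0 h1 h2 h3 C1;
  clear; lia.
Qed.

Lemma split_flacet_descend F x : split_flacet R M F -> relint section x ->
  flat_hyperplane M F x -> exists C,
  [/\ proper_facial C (F :&: C), F = (F :&: C) :|: L,
      forall i, i \in C -> 0 < x i < 1 & \sum_(i in F :&: C) x i = (r (F :&: C))%:R].
Proof.
move=> [/flacet_desc[C [hC C1 hF eF]] _] hx Hx; exists C.
have bnd i := relint_section_bounds hx hC C1 (i := i).
have [[Px _] _] := hx; have /componentP[C0 sC _] := hC.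
have [FC F0 FnC _ _] := hF.
have xT : \sum_i x i = (r [set: T]%SET)%:R.
  by rewrite sum_setT; apply: aff_separator => //; exact: separatorT.
have xC := aff_separator sC Px.
have r0 : (0 < r [set: T]%SET)%N.
  by apply: leq_trans (component_rank_gt0 hC C1 (subxx _) C0) (rankS M (subsetT _)).
have xF : \sum_(i in F :&: C) x i = (r (F :&: C))%:R.
  move/(hyperplaneE _ xT r0): Hx; rewrite {1 2}eF rankUloops sumUloops.
    by rewrite (aff_separator (separator_loops M) Px) rank_loops addr0.
  exact: disjointWl FC (component_loops hC C1).
by split=> //; split=> //; exact: interior_ranks FC F0 FnC bnd xC xF.
Qed.

(** The form in which compatibility is used: adding the loops keeps [F] and [G] distinct and does
    not affect the equations at [y]. *)
Lemma split_matroidP C D F G y : split_matroid R M -> proper_facial C F -> proper_facial D G ->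
  F <> G -> aff P y -> (forall i, ~~ separator M [set i] -> 0 < y i < 1) ->
  \sum_(i in F) y i = (r F)%:R -> \sum_(i in G) y i = (r G)%:R -> False.
Proof.
move=> sM hF hG nFG Py hy yF yG.
have disL A B : proper_facial A B -> [disjoint B & L]%B.
  by move=> [hA A1 [BA _ _ _ _] _]; exact: disjointWl BA (component_loops hA A1).
have nFG' : F :|: L <> G :|: L.
  move=> e; apply: nFG; have cut A B : proper_facial A B -> (B :|: L) :\: L = B.
    move=> /disL dB; rewrite setDUl setDv setU0.
    exact/setDidPl.
  by rewrite -(cut _ _ hF) e (cut _ _ hG).
have := sM _ _ (proper_facial_split hF) (proper_facial_split hG) nFG'.
have r0 : (0 < r [set: T]%SET)%N.
  have [_ _ _ [_ h _]] := hF; have := rankS M (subsetT C); by move: h; clear; lia.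
have yT : \sum_i y i = (r [set: T]%SET)%:R.
  by rewrite sum_setT; apply: aff_separator => //; exact: separatorT.
have H A B : proper_facial A B -> \sum_(i in B) y i = (r B)%:R -> flat_hyperplane M (B :|: L) y.
  move=> hB yB; apply/(hyperplaneE _ yT r0); rewrite rankUloops sumUloops; last exact: disL hB.
  by rewrite (aff_separator (separator_loops M) Py) rank_loops addr0.
rewrite /compatible => /seteqP[/(_ y) + _]; apply; split; last exact: H hG yG.
by split; [exact: relint_section_intro | exact: H hF yF].
Qed.

End SplitMatroid.

(** * Passing between the matroid and its components *)

Section Components.
Local Open Scope ring_scope.
Local Open Scope classical_set_scope.
Variables (R : realType) (T : finType) (M : matroid T).
Implicit Types (A B C D F G S : {set T}).
Local Notation r := (rank M).

Lemma proper_facial_restrict C (F : {set {x : T | x \in C}}) : component M C ->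
  proper_facial (restrict M C) [set: _]%SET F <-> proper_facial M C (val @: F).
Proof.
move=> hC; rewrite /proper_facial !rank_restrict val_imsetT cardsT card_restrict.
rewrite setTD -(card_imset (mem (~: F)) val_inj) val_imsetC.
rewrite -(card_imset (mem F) val_inj).
split=> [[_ ? /facial_restrict ? ?]|[_ ? /facial_restrict ? ?]]; split=> //.
exact: component_restrict.
Qed.

Lemma sum_val C (A : {set {x : T | x \in C}}) (x : {ffun T -> R^o}) :
  \sum_(i in A) x (val i) = \sum_(i in val @: A) x i.
Proof. by rewrite big_imset //= => i j _ _; exact: val_inj. Qed.

Lemma nonuniform_proper_facial C : component M C -> ~ uniform (restrict M C) ->
  exists F, proper_facial M C F.
Proof.
move=> hC nu; have hN := component_restrict hC.
have [F [h1 h2 h3 h4]] := facial_exists hN nu.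
exists (val @: F); apply/(proper_facial_restrict F hC); split=> //; last first.
  by rewrite setTD.
have [_ /set0Pn[i iF] FT _ _] := h1.
have := proper_card (_ : F \proper [set: _]%SET); rewrite properEneq FT subsetT => /(_ isT).
by apply: leq_trans; rewrite ltnS; apply/card_gt0P; exists i.
Qed.

Lemma proper_facial_nonuniform C F : proper_facial M C F -> ~ uniform (restrict M C).
Proof.
move=> [hC _ [FC _ _ _ _] [h1 h2 _]] u.
have := uniform_rank (val @^-1: F) u.
rewrite rank_restrictT rank_restrict val_preimsetK // -(card_imset _ val_inj) val_preimsetK //.
by move: h1 h2; clear; lia.
Qed.

(** A common interior point for the restriction, completed by a barycenter outside [C], is a common
    interior point for [M]. *)
Lemma split_matroid_restrict C : component M C -> split_matroid R M ->
  split_matroid R (restrict M C).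
Proof.
move=> hC sM F G sF sG nFG; apply/seteqP; split=> // x [[hx HF] HG].
have hN := component_restrict hC; have /componentP[_ sC _] := hC.
have desc (A : {set {x : T | x \in C}}) : split_flacet R (restrict M C) A ->
    flat_hyperplane (restrict M C) A x ->
    [/\ proper_facial M C (val @: A), forall i, 0 < x i < 1 &
        \sum_(i in A) x i = (rank (restrict M C) A)%:R].
  move=> sA HA; have [D [hA eA bnd xA]] := split_flacet_descend sA hx HA.
  have [hD _ _ _] := hA; have /componentP[D0 sD _] := hD.
  have eD : D = [set: _]%SET.
    have /componentP[_ _ /(_ D sD (subsetT _))] := hN; case=> // e.
    by rewrite e eqxx in D0.
  rewrite eD setIT in hA bnd xA; split=> //; first exact/proper_facial_restrict.
  by move=> i; apply: bnd; rewrite inE.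
have [pF bnd xF] := desc F sF HF; have [pG _ xG] := desc G sG HG.
have [b Pb hb] := barycenter R M.
have [[Px _] _] := hx.
(* The default 0 outside [C] is overwritten by [b] in the gluing. *)
pose x' : {ffun T -> R^o} := [ffun i => if insub i is Some u then x u else 0].
have x'E (u : {x : T | x \in C}) : x' (val u) = x u by rewrite ffunE valK.
have sum_x' (A : {set {x : T | x \in C}}) :
    \sum_(i in val @: A) x' i = \sum_(i in A) x i.
  by rewrite -sum_val; apply: eq_bigr => u _; rewrite x'E.
have Py : aff (matroid_polytope M) (glue C x' b).
  apply: (aff_glue sC _ (sub_aff Pb)) => S SC hS.
  rewrite -(val_preimsetK SC) sum_x' -rank_restrict; apply: aff_separator Px.
  by rewrite (separator_restrict _ sC) (val_preimsetK SC).
have sum_y (A : {set {x : T | x \in C}}) :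
    \sum_(i in val @: A) glue C x' b i = \sum_(i in A) x i.
  rewrite sum_glue (setIidPl (val_imsetS A)) sum_x'.
  have /eqP -> : val @: A :\: C == set0 by rewrite setD_eq0 val_imsetS.
  by rewrite big_set0 addr0.
apply: (split_matroidP sM pF pG _ Py).
- by move=> e; apply: nFG; exact: val_imset_inj e.
- move=> i hi; rewrite ffunE; case: ifP => iC; last exact: hb.
  by have := bnd (Sub i iC); rewrite -x'E SubK.
- by rewrite sum_y xF rank_restrict.
- by rewrite sum_y xG rank_restrict.
Qed.

(** Hyperplanes from different components constrain disjoint coordinates, so points on each of them
    glue to a common interior point. *)
Lemma split_matroid_unique C D : split_matroid R M -> component M C -> component M D ->
  ~ uniform (restrict M C) -> ~ uniform (restrict M D) -> C = D.
Proof.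
move=> sM hC hD nC nD; apply/eqP; apply: contraT => nCD.
have dCD := component_disjoint hC hD nCD.
have [F pF] := nonuniform_proper_facial hC nC; have [G pG] := nonuniform_proper_facial hD nD.
have [y [Py yF by_]] := proper_facial_point R pF; have [z [Pz zG bz]] := proper_facial_point R pG.
have [b Pb hb] := barycenter R M.
have /componentP[_ sC _] := hC; have /componentP[_ sD _] := hD.
have [_ _ [FC /set0Pn[i iF] _ _ _] _] := pF; have [_ _ [GD _ _ _ _] _] := pG.
have dCG : [disjoint G & C]%B by rewrite disjoint_sym; exact: disjointWr GD dCD.
have Pw : aff (matroid_polytope M) (glue C y (glue D z b)).
  apply: aff_glue sC _ _ => [S _ hS|]; first exact: aff_separator.
  apply: aff_glue sD _ (sub_aff Pb) => S _ hS; exact: aff_separator.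
exfalso.
apply: (split_matroidP sM pF pG _ Pw).
- by move=> e; have := disjointFr dCD (subsetP FC i iF); rewrite (subsetP GD) // -e.
- move=> j hj; rewrite !ffunE; case: ifP => jC; first exact: by_.
  by case: ifP => jD; [exact: bz | exact: hb].
- rewrite sum_glue (setIidPl FC) yF.
  have /eqP -> : F :\: C == set0 by rewrite setD_eq0.
  by rewrite big_set0 addr0.
- rewrite sum_glue disjoint_setI0 // big_set0 add0r (setDidPl dCG).
  rewrite sum_glue (setIidPl GD) zG.
  have /eqP -> : G :\: D == set0 by rewrite setD_eq0.
  by rewrite big_set0 addr0.
Qed.

(** Two flacets meeting in the interior come from non-uniform components, hence from the same [C],
    and the restriction of the common point to [C] contradicts the split property there. *)
Lemma split_matroid_of_components :
  (forall C D, component M C -> component M D -> ~ uniform (restrict M C) ->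
     ~ uniform (restrict M D) -> C = D) ->
  (forall C, component M C -> ~ uniform (restrict M C) -> split_matroid R (restrict M C)) ->
  split_matroid R M.
Proof.
move=> uniq spl F G sF sG nFG; apply/seteqP; split=> // x [[hx HF] HG].
have [C [pF eF bnd xF]] := split_flacet_descend sF hx HF.
have [D [pG eG _ xG]] := split_flacet_descend sG hx HG.
have nC := proper_facial_nonuniform pF; have nD := proper_facial_nonuniform pG.
have [hC _ [FC _ _ _ _] _] := pF; have [hD _ [GD _ _ _ _] _] := pG.
have eCD := uniq C D hC hD nC nD; rewrite -eCD in pG eG xG GD.
have [[Px _] _] := hx; have hN := component_restrict hC; have /componentP[_ sC _] := hC.
pose F' : {set {x : T | x \in C}} := val @^-1: (F :&: C).
pose G' : {set {x : T | x \in C}} := val @^-1: (G :&: C).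
have vF : val @: F' = F :&: C by exact: val_preimsetK.
have vG : val @: G' = G :&: C by exact: val_preimsetK.
pose x' : {ffun {x : T | x \in C} -> R^o} := [ffun u => x (val u)].
have sum_x' (A : {set {x : T | x \in C}}) : \sum_(i in A) x' i = \sum_(i in val @: A) x i.
  by rewrite -sum_val; apply: eq_bigr => u _; rewrite ffunE.
apply: (@split_matroidP _ _ _ [set: _]%SET [set: _]%SET F' G' x' (spl C hC nC)).
- by apply/proper_facial_restrict; rewrite ?vF.
- by apply/proper_facial_restrict; rewrite ?vG.
- by move=> e; apply: nFG; rewrite eF eG -vF -vG e.
- apply/aff_polytope => S; rewrite separator_restrict // => hS.
  by rewrite sum_x' rank_restrict; exact: aff_separator.
- by move=> u _; rewrite ffunE; apply: bnd; exact: valP.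
- by rewrite sum_x' rank_restrict vF.
- by rewrite sum_x' rank_restrict vG.
Qed.

End Components.

Theorem proposition15 (R : realType) (n : nat) (hn : (2 <= n)%N)
    (M : matroid 'I_n) :
  split_matroid R M <->
  (forall C D : {set 'I_n}, component M C -> component M D ->
     nonuniform_split_matroid R (restrict M C) ->
     nonuniform_split_matroid R (restrict M D) -> C = D) /\
  (forall C : {set 'I_n}, component M C ->
     ~ nonuniform_split_matroid R (restrict M C) -> uniform (restrict M C)).
Proof.
split=> [sM|[uniq unif]].
  split=> [C D hC hD [_ nC] [_ nD]|C hC ns]; first exact: split_matroid_unique sM hC hD nC nD.
  apply: contrapT => nu; apply: ns; split=> //; exact: split_matroid_restrict hC sM.
(* The contrapositive of the second clause: a non-uniform component is a split matroid. *)
have spl C : component M C -> ~ uniform (restrict M C) ->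
    nonuniform_split_matroid R (restrict M C).
  by move=> hC nu; apply: contrapT => ns; apply: nu; exact: unif hC ns.
apply: split_matroid_of_components => [C D hC hD nC nD|C hC nC].
  by apply: uniq => //; exact: spl.
by have [] := spl C hC nC.
Qed.
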